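(* Let $d\ge1$, $\delta>0$, and $N\ge d+2$. Let $\varphi_1,\dots,\varphi_N$ be i.i.d. random vectors uniformly distributed on $\mathbb{S}^{d-1}$, and $\epsilon_1,\dots,\epsilon_N$ i.i.d. uniform on $[-\delta,\delta]$, independent of the $\varphi_n$. Let $P_N=\bigcap_{n=1}^N\{u\in\mathbb{R}^d:|\langle u,\varphi_n\rangle-\epsilon_n|\le\delta\}$ and $W_N=\sup\{\|u\|:u\in P_N\}$. Then $$\mathbb{E}|W_N|^2\le\frac{2e^{12}\delta^2d^3}{(N+1)(N+2)}+26\delta^2d^{3/2}\Big(\frac{11}{12}\Big)^{N/2}e^{\frac{d\ln(1024d)}{2}}.$$ In particular, writing $W_N=W_N^{(d)}$ to indicate the dimension, $$\limsup_{d\to\infty}\mathbb{E}|W^{(d)}_{\lceil d^{3/2}\rceil}|^2\le2e^{12}\delta^2\qquad\text{and}\qquad\lim_{d\to\infty}\mathbb{E}|W^{(d)}_{\lceil d^{3/2}\ln d\rceil}|^2=0.$$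
   Context: $\mathbb{S}^{d-1}$ is the unit sphere of $\mathbb{R}^d$ with normalized surface measure. $W_N$ is the worst case error of consistent reconstruction from measurements $q_n=\langle x,\varphi_n\rangle+\epsilon_n$. *)

(* Defs.v *)
From HB Require Import structures.
From mathcomp Require Import all_boot all_order all_algebra.
From mathcomp Require Import all_classical all_reals all_analysis.
Set Implicit Arguments. Unset Strict Implicit. Unset Printing Implicit Defensive.
Import Order.TTheory GRing.Theory Num.Theory.
Import numFieldNormedType.Exports.
Local Open Scope classical_set_scope.
Local Open Scope ring_scope.

Definition dotp (R : realType) (d : nat) (u v : 'rV[R]_d) : R :=
  \sum_(i < d) u ord0 i * v ord0 i.
Definition enorm (R : realType) (d : nat) (u : 'rV[R]_d) : R :=
  Num.sqrt (dotp u u).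

Definition rV_borel (R : realType) (d : nat) : set (set 'rV[R]_d) :=
  <<s [set A : set 'rV[R]_d | open A] >>.

(* d-dimensional Lebesgue measure, defined by iterated 1-dim Lebesgue
   integrals (Tonelli); points are encoded as nat -> R (first n coords). *)
Definition ncons (R : realType) (x : R) (y : nat -> R) : nat -> R :=
  fun k => if k is k'.+1 then y k' else x.
Fixpoint vol (R : realType) (n : nat) (E : set (nat -> R)) : \bar R :=
  match n with
  | 0 => if `[< E (fun _ => 0) >] then 1%E else 0%E
  | n'.+1 => (\int[@lebesgue_measure R]_x vol n' [set y | E (ncons x y)])%E
  end.
Definition lvol (R : realType) (d : nat) (A : set 'rV[R]_d) : \bar R :=
  vol d [set f | A (\row_(i < d) f (nat_of_ord i))].

(* normalized surface measure on S^{d-1} (cone measure):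
   sigma(B) = vol{t x : 0 < t <= 1, x in B, |x| = 1} / vol(unit ball) *)
Definition unit_sphere (R : realType) (d : nat) : set 'rV[R]_d :=
  [set x | enorm x = 1].
Definition sphere_cone (R : realType) (d : nat) (B : set 'rV[R]_d) : set 'rV[R]_d :=
  [set u | exists t x, [/\ 0 < t <= 1, B x, enorm x = 1 & u = t *: x]].
Definition sphere_measure (R : realType) (d : nat) (B : set 'rV[R]_d) : \bar R :=
  (lvol (sphere_cone B) * ((fine (lvol [set u : 'rV[R]_d | enorm u <= 1]))^-1)%:E)%E.

Definition event_family (R : realType) (dsp : measure_display) (T : measurableType dsp)
  (d N : nat) (phi : 'I_N -> T -> 'rV[R]_d) (eps : 'I_N -> T -> R)
  (i : ('I_N + 'I_N)%type) : set (set T) :=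
  match i with
  | inl n => [set A | exists2 B, rV_borel B & A = phi n @^-1` B]
  | inr n => [set A | exists2 B, measurable B & A = eps n @^-1` B]
  end.

Definition model (R : realType) (dsp : measure_display) (T : measurableType dsp)
  (P : probability T R) (d N : nat) (delta : R)
  (phi : 'I_N -> T -> 'rV[R]_d) (eps : 'I_N -> T -> R) : Prop :=
  [/\
      (forall n B, rV_borel B -> measurable (phi n @^-1` B)),
      (forall n, measurable_fun setT (eps n)),
      (forall (J : {set ('I_N + 'I_N)%type}) (A : ('I_N + 'I_N)%type -> set T),
          (forall i, i \in J -> event_family phi eps i (A i)) ->
          P [set w | forall i, i \in J -> A i w] = (\prod_(i in J) P (A i))%E),
      (forall n B, rV_borel B -> P (phi n @^-1` B) = sphere_measure B) &
      (forall n B, measurable B ->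
          P (eps n @^-1` B) =
          (lebesgue_measure (B `&` [set x | (- delta <= x <= delta)%R])
            * ((2 * delta)^-1)%:E)%E)].

Definition PN (R : realType) (dsp : measure_display) (T : measurableType dsp)
  (d N : nat) (delta : R) (phi : 'I_N -> T -> 'rV[R]_d) (eps : 'I_N -> T -> R)
  (w : T) : set 'rV[R]_d :=
  [set u | forall n : 'I_N, `|dotp u (phi n w) - eps n w| <= delta].
Definition WN (R : realType) (dsp : measure_display) (T : measurableType dsp)
  (d N : nat) (delta : R) (phi : 'I_N -> T -> 'rV[R]_d) (eps : 'I_N -> T -> R)
  (w : T) : \bar R :=
  ereal_sup [set (enorm u)%:E | u in PN delta phi eps w].
Definition EW2 (R : realType) (dsp : measure_display) (T : measurableType dsp)
  (P : probability T R) (d N : nat) (delta : R)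
  (phi : 'I_N -> T -> 'rV[R]_d) (eps : 'I_N -> T -> R) : \bar R :=
  (\int[P]_w (`| WN delta phi eps w | ^+ 2))%E.

(* Main.v *)
(* If [W_N > r], then [P_N] contains a point [x] with [<x, e> >= t] for some
   direction [e] of a finite family, and since [P_N] is convex and contains [0],
   the section [{<x, e> = t}] of [P_N] is nonempty. A polyhedron of this kind
   has a point determined by at most [d - 1] tight slabs. Given these slabs the
   point is fixed and has norm at least [t], and the remaining slabs are
   independent of it, so a union bound over the sets of tight slabs reduces the
   estimate of [P (W_N > r)] to the probability that a fixed vector survives one
   slab. The latter follows from [P (|<v, phi>| <= a) <= 2 a sqrt d / |v|], which
   compares the volume of a central slab of the ball with that of the ball.
   The second moment is then summed dyadically, with a net of [64^d] directions
   and only the data with [|eps_n|] close to [delta] for moderate [r], and with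
   the coordinate axes and all the data for large [r]. *)

Require Import Defs.
From HB Require Import structures.
From mathcomp Require Import all_boot all_order all_algebra.
From mathcomp Require Import all_classical all_reals all_analysis measurable_realfun.
From mathcomp Require Import ring lra zify.
Set Implicit Arguments. Unset Strict Implicit. Unset Printing Implicit Defensive.
Import Order.TTheory GRing.Theory Num.Theory.
Import numFieldNormedType.Exports.
Local Open Scope classical_set_scope.
Local Open Scope ring_scope.

(** * Canonical solutions of linear systems *)

Section Vertex.
Context {R : realType}.

Lemma dotpE d (u v : 'rV[R]_d) : dotp u v = (u *m v^T) ord0 ord0.
Proof. by rewrite mxE; apply: eq_bigr => i _; rewrite mxE. Qed.

Lemma dotpC d (u v : 'rV[R]_d) : dotp u v = dotp v u.
Proof. by apply: eq_bigr => i _; rewrite mulrC. Qed.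

Lemma dotpDl d (u v w : 'rV[R]_d) : dotp (u + v) w = dotp u w + dotp v w.
Proof. by rewrite !dotpE mulmxDl mxE. Qed.

Lemma dotpZl d a (u w : 'rV[R]_d) : dotp (a *: u) w = a * dotp u w.
Proof. by rewrite !dotpE -scalemxAl mxE. Qed.

Lemma dotpBl d (u v w : 'rV[R]_d) : dotp (u - v) w = dotp u w - dotp v w.
Proof. by rewrite !dotpE mulmxBl !mxE. Qed.

Lemma dotpZr d a (u w : 'rV[R]_d) : dotp w (a *: u) = a * dotp w u.
Proof. by rewrite dotpC dotpZl dotpC. Qed.

Lemma dotp_ge0 d (u : 'rV[R]_d) : 0 <= dotp u u.
Proof. by apply: sumr_ge0 => i _; rewrite -expr2 sqr_ge0. Qed.

Lemma dotp_eq0 d (u : 'rV[R]_d) : dotp u u = 0 -> u = 0.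
Proof.
move=> /eqP; rewrite psumr_eq0 => [/allP u0|i _]; last by rewrite -expr2 sqr_ge0.
apply/rowP => i; have := u0 i; rewrite mem_index_enum => /(_ isT) /=.
by rewrite mulf_eq0 orbb mxE => /eqP.
Qed.

Lemma dotp_row m d (y : 'rV[R]_m) (A : 'M[R]_(m, d)) x :
  dotp x (y *m A) = \sum_i y ord0 i * dotp x (row i A).
Proof.
rewrite dotpC dotpE -mulmxA mxE; apply: eq_bigr => i _; congr (_ * _).
by rewrite mxE; apply: eq_bigr => j _; rewrite !mxE mulrC.
Qed.

Definition row_mask m d (T : {set 'I_m}) (A : 'M[R]_(m, d)) : 'M[R]_(m, d) :=
  \matrix_(i, j) (if i \in T then A i j else 0).

Definition gram m d (T : {set 'I_m}) (A : 'M[R]_(m, d)) : 'M[R]_m :=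
  row_mask T A *m (row_mask T A)^T + diag_mx (\row_i (i \notin T)%:R).

(* A canonical solution [x] of the equations [<x, A_i> = c_i], [i \in T], that
   depends on the data through rational functions only; it is meaningful when
   [gram T A] is invertible, i.e. when the rows [A_i], [i \in T], are free. *)
Definition vertex m d (T : {set 'I_m}) (A : 'M[R]_(m, d)) (c : 'rV[R]_m)
    : 'rV[R]_d :=
  c *m invmx (gram T A) *m row_mask T A.

Lemma mul_row_mask m d (T : {set 'I_m}) (A : 'M[R]_(m, d)) (y : 'rV[R]_m) :
  y *m row_mask T A = (\row_i (if i \in T then y ord0 i else 0)) *m A.
Proof.
apply/rowP => j; rewrite !mxE; apply: eq_bigr => i _; rewrite !mxE.
by case: ifP; rewrite ?mulr0 ?mul0r.
Qed.

Lemma mul_diag_out m (T : {set 'I_m}) (y : 'rV[R]_m) i :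
  (y *m diag_mx (\row_i (i \notin T)%:R)) ord0 i = y ord0 i * (i \notin T)%:R.
Proof. by rewrite mul_mx_diag !mxE. Qed.

Lemma vertexE m d (T : {set 'I_m}) (A : 'M[R]_(m, d)) c i :
  gram T A \in unitmx -> i \in T -> dotp (vertex T A c) (row i A) = c ord0 i.
Proof.
move=> uG iT.
have -> : dotp (vertex T A c) (row i A) =
    (c *m invmx (gram T A) *m (row_mask T A *m (row_mask T A)^T)) ord0 i.
  rewrite /vertex mulmxA mxE; apply: eq_bigr => j _; congr (_ * _).
  by rewrite !mxE iT.
have /(congr1 (fun z : 'rV_m => z ord0 i)) : c *m invmx (gram T A) *m gram T A = c.
  by rewrite mulmxKV.
by rewrite mulmxDr mxE mul_diag_out iT mulr0 addr0.
Qed.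

Lemma gram_unitP m d (T : {set 'I_m}) (A : 'M[R]_(m, d)) :
  reflect (forall y : 'rV[R]_m,
             (forall i, i \notin T -> y ord0 i = 0) -> y *m A = 0 -> y = 0)
          (gram T A \in unitmx).
Proof.
apply: (iffP idP) => [uG y y0 yA|inj].
- have yM : y *m row_mask T A = 0.
    rewrite mul_row_mask -[RHS]yA; congr (_ *m _); apply/rowP => i; rewrite !mxE.
    by case: ifPn => // /y0.
  have yG : y *m gram T A = 0.
    rewrite mulmxDr mulmxA yM mul0mx add0r; apply/rowP => i.
    by rewrite mul_diag_out [RHS]mxE; case: (boolP (i \in T)) => [_|/y0->];
      rewrite ?mulr0 ?mul0r.
  by rewrite -[y](mulmxK uG) yG mul0mx.
- rewrite -row_free_unit; apply/inj_row_free => y yG.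
  have : dotp y (y *m gram T A) = 0.
    by rewrite yG dotpE trmx0 mulmx0 mxE.
  have -> : dotp y (y *m gram T A) =
      dotp (y *m row_mask T A) (y *m row_mask T A)
      + \sum_i (y ord0 i) ^+ 2 * (i \notin T)%:R.
    rewrite mulmxDr dotpC dotpDl; congr (_ + _).
      by rewrite !dotpE trmx_mul !mulmxA.
    apply: eq_bigr => i _; rewrite mul_diag_out expr2; ring.
  have sq0 i : true -> 0 <= (y ord0 i) ^+ 2 * (i \notin T)%:R by rewrite mulr_ge0 ?sqr_ge0.
  move=> /eqP; rewrite paddr_eq0 ?dotp_ge0 ?sumr_ge0// => /andP[/eqP/dotp_eq0 yM].
  rewrite psumr_eq0// => /allP yT.
  have y0 i : i \notin T -> y ord0 i = 0.
    move=> iT; have := yT i; rewrite mem_index_enum => /(_ isT) /=.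
    by rewrite iT mulr1 sqrf_eq0 => /eqP.
  apply: inj => //; rewrite -yM mul_row_mask; congr (_ *m _); apply/rowP => i.
  by rewrite mxE; case: ifPn => // /y0.
Qed.

Lemma gram_card m d (T : {set 'I_m}) (A : 'M[R]_(m, d)) :
  gram T A \in unitmx -> (#|T| <= d)%N.
Proof.
move=> uG; have rG : \rank (gram T A) = m by rewrite mxrank_unit.
have r1 : (\rank (row_mask T A *m (row_mask T A)^T) <= d)%N.
  by rewrite (leq_trans (mxrankM_maxl _ _))// rank_leq_col.
have r2 : (\rank (diag_mx (\row_i (i \notin T)%:R) : 'M[R]_m) <= #|~: T|)%N.
  have -> : diag_mx (\row_i (i \notin T)%:R) =
      \sum_(i in ~: T) delta_mx i i :> 'M[R]_m.
    apply/matrixP => i j; rewrite summxE mxE.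
    under eq_bigr do rewrite mxE.
    case: (boolP (i \in T)) => iT.
      rewrite big1 ?mxE ?iT ?mul0rn// => k.
      by rewrite inE => kT; case: eqP => // ik; move: kT; rewrite -ik iT.
    rewrite (bigD1 i) ?inE//= big1 => [|k /andP[_ /negbTE ki]].
      by rewrite mxE iT eqxx addr0 eq_sym.
    by rewrite eq_sym ki.
  rewrite -sum1_card; elim/big_rec2: _ => [|i k B _ kB]; first by rewrite mxrank0.
  by rewrite (leq_trans (mxrank_add _ _))// mxrank_delta leq_add2l.
have := leq_trans (mxrank_add (row_mask T A *m (row_mask T A)^T) _) (leq_add r1 r2).
rewrite -/(gram T A) rG => mle.
by rewrite -(leq_add2r #|~: T|) cardsC card_ord.
Qed.

Lemma gram_setU1 m d (T : {set 'I_m}) (A : 'M[R]_(m, d)) j (x x' : 'rV[R]_d) :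
  gram T A \in unitmx ->
  (forall i, i \in T -> dotp x (row i A) = dotp x' (row i A)) ->
  dotp x (row j A) != dotp x' (row j A) ->
  gram (j |: T) A \in unitmx.
Proof.
move=> /gram_unitP inj xx' xj; apply/gram_unitP => y y0 yA.
have jT : j \notin T by apply: contra xj => /xx' ->.
have yj : y ord0 j = 0.
  have : dotp (x - x') (y *m A) = 0 by rewrite yA dotpE trmx0 mulmx0 mxE.
  rewrite dotp_row (bigD1 j)//= big1 ?addr0 => [/eqP|i ij].
    by rewrite mulf_eq0 dotpBl subr_eq0 (negbTE xj) orbF => /eqP.
  rewrite dotpBl; case: (boolP (i \in T)) => [/xx' ->|iT].
    by rewrite subrr mulr0.
  by rewrite y0 ?mul0r// !inE negb_or ij.
apply: inj => // i iT; have [->//|ij] := eqVneq i j.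
by apply: y0; rewrite !inE negb_or ij.
Qed.

End Vertex.

(** * Vertices of intersections of slabs *)

Section SlabVertex.
Context {R : realType} {d N : nat}.
Implicit Types (tau : {ffun 'I_N -> option bool}) (F : 'M[R]_(N, d)).

Definition tau_supp tau : {set 'I_N} := [set n | tau n != None].

Definition tau_index tau : {set 'I_(1 + N)} :=
  [set i | if fintype.split i is inr n then tau n != None else true].

Definition slab_side (lo hi : 'I_N -> R) tau : 'rV[R]_N :=
  \row_n (if tau n is Some b then if b then hi n else lo n else 0).

(* The point selected by [tau]: it lies on the hyperplane [<x, e> = t] and, for
   every [n] in the support of [tau], on the upper ([Some true]) or lower
   ([Some false]) face of the [n]th slab. *)
Definition slab_vertex (e : 'rV[R]_d) F (t : R) tau lo hi : 'rV[R]_d :=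
  vertex (tau_index tau) (col_mx e F) (row_mx t%:M (slab_side lo hi tau)).

Lemma tau_index_lshift tau i : lshift N i \in tau_index tau.
Proof. by rewrite inE (unsplitK (inl i)). Qed.

Lemma tau_index_rshift tau n : (rshift 1 n \in tau_index tau) = (tau n != None).
Proof. by rewrite inE (unsplitK (inr n)). Qed.

Lemma card_tau_index tau : #|tau_index tau| = #|tau_supp tau|.+1.
Proof.
have -> : tau_index tau = lshift N ord0 |: [set rshift 1 n | n in tau_supp tau].
  apply/setP => i; rewrite !inE; case: (split_ordP i) => j ->.
    by rewrite (ord1 j) eqxx.
  rewrite [X in _ = X || _](_ : _ = false); last by apply/eqP => /(congr1 val).
  by rewrite mem_imset ?inE//; exact: rshift_inj.
rewrite cardsU1 card_imset; last exact: rshift_inj.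
rewrite (_ : _ \notin _ = true)//; apply/negP => /imsetP[n _] /(congr1 val).
by [].
Qed.

Lemma slab_vertex_e e F t tau lo hi :
  gram (tau_index tau) (col_mx e F) \in unitmx ->
  dotp (slab_vertex e F t tau lo hi) e = t.
Proof.
move=> uG; have := vertexE (row_mx t%:M (slab_side lo hi tau)) uG
  (tau_index_lshift tau ord0).
by rewrite rowKu row_id row_mxEl mxE eqxx mulr1n.
Qed.

Lemma slab_vertex_row e F t tau lo hi n :
  gram (tau_index tau) (col_mx e F) \in unitmx -> tau n != None ->
  dotp (slab_vertex e F t tau lo hi) (row n F) =
  slab_side lo hi tau ord0 n.
Proof.
move=> uG; rewrite -tau_index_rshift => /(vertexE (row_mx t%:M (slab_side lo hi tau)) uG).
by rewrite rowKd row_mxEr.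
Qed.

Lemma segment_hits_slab (x p l h : R) : l <= x <= h -> ~~ (l <= p <= h) ->
  exists s, [/\ 0 <= s, forall s', 0 <= s' <= s -> l <= x + s' * (p - x) <= h,
                s <= 1 & x + s * (p - x) = if h < p then h else l].
Proof.
move=> /andP[lx xh]; rewrite negb_and -!ltNge => lph.
case: ltP => [hp|ph].
- have px : 0 < p - x by lra.
  exists ((h - x) / (p - x)); split.
  + by rewrite divr_ge0; lra.
  + move=> s' /andP[s0]; rewrite ler_pdivlMr// => s1.
    have := mulr_ge0 s0 (ltW px); lra.
  + by rewrite ler_pdivrMr// mul1r; lra.
  + by rewrite mulfVK; [ring|rewrite gt_eqF].
- have {}lph : p < l by case/orP: lph => //; lra.
  have px : 0 < x - p by lra.
  exists ((x - l) / (x - p)); split.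
  + by rewrite divr_ge0; lra.
  + move=> s' /andP[s0]; rewrite ler_pdivlMr// => s1.
    have := mulr_ge0 s0 (ltW px); lra.
  + by rewrite ler_pdivrMr// mul1r; lra.
  + by rewrite -(opprB x p) mulrN mulfVK; [ring|rewrite gt_eqF].
Qed.

Lemma convex_slab (x p l h s : R) : l <= x <= h -> l <= p <= h -> 0 <= s <= 1 ->
  l <= x + s * (p - x) <= h.
Proof.
move=> /andP[lx xh] /andP[lp ph] /andP[s0 s1].
have -> : x + s * (p - x) = (1 - s) * x + s * p by ring.
have s1' : 0 <= 1 - s by lra.
have := mulr_ge0 s1' (_ : 0 <= x - l); have := mulr_ge0 s1' (_ : 0 <= h - x).
have := mulr_ge0 s0 (_ : 0 <= p - l); have := mulr_ge0 s0 (_ : 0 <= h - p).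
move=> /(_ ltac:(lra)) h1 /(_ ltac:(lra)) h2 /(_ ltac:(lra)) h3 /(_ ltac:(lra)) h4.
by apply/andP; split; lra.
Qed.

Definition vertex_witness e F (t : R) (rel : pred 'I_N) lo hi tau :=
  [/\ forall n, tau n != None -> rel n,
      (#|tau_supp tau| < d)%N,
      dotp (slab_vertex e F t tau lo hi) e = t &
      forall n, rel n ->
        lo n <= dotp (slab_vertex e F t tau lo hi) (row n F) <= hi n].

(* Among the feasible points of the affine space cut out by [tau], walk from
   [x] towards the canonical point of that space; if the latter is not feasible,
   the first slab that is left provides one more independent tight constraint. *)
Lemma slab_vertex_step e F t (rel : pred 'I_N) lo hi k tau x :
  (d <= #|tau_supp tau| + k)%N ->
  gram (tau_index tau) (col_mx e F) \in unitmx ->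
  (forall n, tau n != None -> rel n) ->
  dotp x e = t -> (forall n, rel n -> lo n <= dotp x (row n F) <= hi n) ->
  (forall n, tau n != None -> dotp x (row n F) = slab_side lo hi tau ord0 n) ->
  exists tau', vertex_witness e F t rel lo hi tau'.
Proof.
elim: k tau x => [|k IH] tau x.
  rewrite addn0 => dk uG _ _ _ _; have := gram_card uG.
  by rewrite card_tau_index ltnNge dk.
move=> dk uG rtau xe xrel xtau; set p := slab_vertex e F t tau lo hi.
have pe : dotp p e = t by exact: slab_vertex_e.
pose bad n := rel n && ~~ (lo n <= dotp p (row n F) <= hi n).
have [|/existsPn nobad] := boolP [exists n, bad n]; last first.
  exists tau; split => //.
  - by have := gram_card uG; rewrite card_tau_index.
  - by move=> n rn; have := nobad n; rewrite negb_and negbK rn.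
case/existsP => j0 badj0.
have /choice[s sP] n : exists s, bad n -> [/\ 0 <= s,
    forall s', 0 <= s' <= s ->
      lo n <= dotp x (row n F) + s' * (dotp p (row n F) - dotp x (row n F)) <= hi n,
    s <= 1 & dotp x (row n F) + s * (dotp p (row n F) - dotp x (row n F)) =
             if hi n < dotp p (row n F) then hi n else lo n].
  have [/andP[rn pn]|_] := boolP (bad n); last by exists 0.
  by have [s sP] := segment_hits_slab (xrel _ rn) pn; exists s.
case: (@Order.TotalTheory.arg_minP _ _ _ j0 bad s badj0) => j badj sj.
have [sj0 sjP sj1 yj] := sP j badj; have /andP[rj pj] := badj.
have xt n : tau n != None -> dotp p (row n F) = dotp x (row n F).
  by move=> tn; rewrite xtau// slab_vertex_row.
have pxj : dotp p (row j F) != dotp x (row j F).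
  by apply: contra pj => /eqP ->; exact: xrel.
have tj : tau j = None.
  by apply/eqP; apply: contraNT pxj => /xt ->.
set y := x + s j *: (p - x).
have yE n : dotp y (row n F) =
    dotp x (row n F) + s j * (dotp p (row n F) - dotp x (row n F)).
  by rewrite dotpDl dotpZl dotpBl.
pose tau' : {ffun 'I_N -> option bool} :=
  [ffun n => if n == j then Some (hi j < dotp p (row j F)) else tau n].
have tau'E n : (tau' n != None) = (n == j) || (tau n != None).
  by rewrite ffunE; case: (n == j).
have supp' : tau_supp tau' = j |: tau_supp tau.
  by apply/setP => n; rewrite !inE tau'E.
apply: (IH tau' y).
- by rewrite supp' cardsU1 inE tj eqxx /= add1n addSnnS.
- have -> : tau_index tau' = rshift 1 j |: tau_index tau.
    apply/setP => i; rewrite !inE; case: (split_ordP i) => k' ->.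
      by rewrite orbT.
    by rewrite tau'E (inj_eq (@rshift_inj _ _)).
  apply: (gram_setU1 (x := p) (x' := x)) => //; last by rewrite rowKd.
  move=> i; case: (split_ordP i) => k' ->; last first.
    by rewrite tau_index_rshift rowKd; exact: xt.
  by rewrite rowKu (ord1 k') row_id xe pe.
- by move=> n; rewrite tau'E => /orP[/eqP ->|/rtau].
- by rewrite dotpDl dotpZl dotpBl xe pe subrr mulr0 addr0.
- move=> n rn; rewrite yE.
  have [pn|pn] := boolP (lo n <= dotp p (row n F) <= hi n).
    by apply: convex_slab => //; [exact: xrel|rewrite sj0 sj1].
  have badn : bad n by rewrite /bad rn.
  have [_ snP _ _] := sP n badn.
  by apply: snP; rewrite sj0 sj.
- move=> n; rewrite tau'E mxE ffunE yE.
  case: eqP => [->|nj] /= tn.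
    by rewrite yj.
  by rewrite xt// subrr mulr0 addr0 xtau// mxE.
Qed.

Lemma slab_vertex_exists e F t (rel : pred 'I_N) lo hi x :
  e != 0 -> dotp x e = t ->
  (forall n, rel n -> lo n <= dotp x (row n F) <= hi n) ->
  exists tau, vertex_witness e F t rel lo hi tau.
Proof.
move=> e0 xe xrel; pose tau : {ffun 'I_N -> option bool} := [ffun=> None].
apply: (@slab_vertex_step e F t rel lo hi d tau x) => //.
- exact: leq_addl.
- apply/gram_unitP => y y0 yA.
  have yr i : y ord0 (rshift 1 i) = 0.
    by apply: y0; rewrite tau_index_rshift ffunE.
  have r0 : rsubmx y = 0 by apply/rowP => i; rewrite !mxE.
  move: yA; rewrite -[y]hsubmxK mul_row_col r0 mul0mx addr0.
  rewrite [lsubmx y]mx11_scalar mul_scalar_mx => /eqP.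
  rewrite scaler_eq0 (negbTE e0) orbF => /eqP ->.
  by rewrite raddf0 row_mx0.
- by move=> n; rewrite ffunE.
- by move=> n; rewrite ffunE.
Qed.

End SlabVertex.

(** * Affine changes of variables and plane rotations *)

Section AffineChange.
Context {R : realType}.
Local Open Scope ereal_scope.
Local Notation mu := (@lebesgue_measure R).

Lemma ge0_le_integralT d (T : measurableType d) (m : {measure set T -> \bar R})
    (f g : T -> \bar R) :
  (forall x, 0 <= f x) -> (forall x, f x <= g x) ->
  \int[m]_x f x <= \int[m]_x g x.
Proof.
move=> f0 fg; have g0 x : 0 <= g x by exact: le_trans (fg x).
rewrite !ge0_integralTE//; apply: le_ereal_sup => _ [h hf <-]; exists h => // x.
exact: le_trans (hf x) (fg x).
Qed.

Definition affine (a b : R) : measurableTypeR R -> measurableTypeR R :=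
  fun x => (a * x + b)%R.

Lemma measurable_affine (a b : R) : measurable_fun setT (affine a b).
Proof. by apply: measurable_funD => //; exact: measurable_funM. Qed.

Lemma lebesgue_measure_affine (a b : R) (A : set R) : (a != 0)%R -> measurable A ->
  mu A = `|a|%:E * pushforward mu (affine a b) A.
Proof.
move=> a0 mA.
have uniq := @lebesgue_measure_unique R
  (mscale (NngNum (normr_ge0 a)) (pushforward mu (affine a b))).
rewrite (uniq (measurable_affine a b) _ A mA)// => _ [[u v]] _ <-.
change (mu `]u, v] = `|a|%:E * mu ((fun x => (a * x + b)%R) @^-1` `]u, v])).
have [a_gt0|a_lt0|a_eq0] := ltgtP 0%R a; last by rewrite -a_eq0 eqxx in a0.
- rewrite (_ : _ @^-1` _ = `]((u - b) / a)%R, ((v - b) / a)%R]%classic); last first.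
    by apply/seteqP; split => x /=; rewrite !in_itv /= ltr_pdivrMr// ler_pdivlMr//
      ltrBlDr lerBrDr ![(x * a)%R]mulrC.
  rewrite !lebesgue_measure_itv /= !lte_fin ltr_pM2r ?invr_gt0// ltrD2r.
  case: ifP => _; last by rewrite mule0.
  rewrite -!EFinD -EFinM (gtr0_norm a_gt0); congr EFin.
  by rewrite -mulrBl mulrC divfK ?gt_eqF//; ring.
- rewrite (_ : _ @^-1` _ = `[((v - b) / a)%R, ((u - b) / a)%R[%classic); last first.
    by apply/seteqP; split => x /=; rewrite !in_itv /= ler_ndivrMr// ltr_ndivlMr//
      ltrBlDr lerBrDr ![(x * a)%R]mulrC andbC.
  rewrite !lebesgue_measure_itv /= !lte_fin ltr_nM2r ?invr_lt0// ltrD2r.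
  case: ifP => _; last by rewrite mule0.
  rewrite -!EFinD -EFinM (ltr0_norm a_lt0); congr EFin.
  by rewrite -mulrBl mulNr mulrC divfK ?lt_eqF//; ring.
Qed.

Lemma integral_affine (a b : R) (f : R -> \bar R) : (a != 0)%R ->
  measurable_fun setT f -> (forall x, 0 <= f x) ->
  \int[mu]_x f x = `|a|%:E * \int[mu]_x f (a * x + b)%R.
Proof.
move=> a0 mf f0.
have := @ge0_integral_pushforward _ _ _ _ R _ (measurable_affine a b) mu setT f
  measurableT mf (fun x _ => f0 x).
rewrite preimage_setT => <-.
have scale := @ge0_integral_mscale _ _ R (pushforward mu (affine a b)).
have := scale (measurable_affine a b) setT measurableT
  (NngNum (normr_ge0 a)) f mf (fun x _ => f0 x).
rewrite /= => <-.
by apply: eq_measure_integral => A mA _; exact: lebesgue_measure_affine.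
Qed.

Lemma measurable_integral2 (f : R -> R -> \bar R) :
  measurable_fun setT (fun z : R * R => f z.1 z.2) -> (forall x y, 0 <= f x y) ->
  measurable_fun setT (fun x => \int[mu]_y f x y).
Proof.
move=> mf f0.
exact: (@measurable_fun_fubini_tonelli_F _ _ _ _ _ mu (fun z => f z.1 z.2) mf
  (fun z => f0 z.1 z.2)).
Qed.

(* Substitute [p = a x + b z] for [z], exchange the integrals, then substitute
   [q = (x - a p) / b] for [x]; indeed [x^2 + z^2 = p^2 + q^2]. *)
Lemma rotation_integral (F : R -> R -> \bar R) (a b : R) :
  measurable_fun setT (fun z : R * R => F z.1 z.2) -> (forall x y, 0 <= F x y) ->
  (a ^+ 2 + b ^+ 2 = 1)%R ->
  \int[mu]_x \int[mu]_z F (x ^+ 2 + z ^+ 2)%R (a * x + b * z)%R =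
  \int[mu]_p \int[mu]_q F (p ^+ 2 + q ^+ 2)%R p.
Proof.
move=> mF F0 ab1.
have mFc d (T : measurableType d) (u v : T -> R) : measurable_fun setT u ->
    measurable_fun setT v -> measurable_fun setT (fun x => F (u x) (v x)).
  move=> mu' mv; apply: (measurableT_comp mF (g := fun x => (u x, v x))).
  exact: measurable_fun_pair.
have [b0|b0] := eqVneq b 0%R.
  have a2 : (a ^+ 2 = 1)%R by rewrite -ab1 b0 expr0n addr0.
  have na : `|a|%R = 1%R by apply/eqP; rewrite -sqrp_eq1// real_normK ?num_real// a2.
  have a0 : (a != 0)%R by rewrite -normr_eq0 na oner_eq0.
  rewrite [RHS](@integral_affine a 0%R)//.
  - rewrite na mul1e; apply: eq_integral => x _; apply: eq_integral => z _.
    by rewrite b0 mul0r !addr0 exprMn a2 mul1r.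
  - apply: measurable_integral2 => //.
    by apply: mFc => //; apply: measurable_funD; exact: measurable_funX.
  - by move=> x; apply: integral_ge0.
have nb : `|b|%:E \is a fin_num by [].
have nb0 : (`|b| != 0)%R by rewrite normr_eq0.
pose K (x p : R) := F (x ^+ 2 + ((p - a * x) / b) ^+ 2)%R p.
have mK : measurable_fun setT (fun z : R * R => K z.1 z.2).
  apply: mFc => //; apply: measurable_funD; first exact: measurable_funX.
  apply: measurable_funX; apply: measurable_funM => //; apply: measurable_funB => //.
  exact: measurable_funM.
have mK1 x : measurable_fun setT (K x).
  apply: mFc => //; apply: measurable_funD => //; apply: measurable_funX.
  by apply: measurable_funM => //; exact: measurable_funB.
have sub1 x : `|b|%:E * \int[mu]_z F (x ^+ 2 + z ^+ 2)%R (a * x + b * z)%R =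
    \int[mu]_p K x p.
  rewrite [RHS](@integral_affine b (a * x)%R)//; last by move=> p; exact: F0.
  congr (_ * _); apply: eq_integral => z _; rewrite /K; congr F.
    by rewrite addrK mulrC mulKf.
  by rewrite addrC.
have sub2 p : \int[mu]_x K x p = `|b|%:E * \int[mu]_q F (p ^+ 2 + q ^+ 2)%R p.
  have bV0 : (b^-1 != 0)%R by rewrite invr_neq0.
  rewrite (@integral_affine b^-1 (- (a * p / b))%R (fun q => F (p ^+ 2 + q ^+ 2)%R p))//.
  - rewrite muleA -EFinM normfV mulfV// mul1e; apply: eq_integral => x _.
    rewrite /K; congr F.
    transitivity (((x - a * p) ^+ 2 + p ^+ 2 * (1 - a ^+ 2)) / b ^+ 2 +
      (a ^+ 2 + b ^+ 2 - 1) * (x ^+ 2 / b ^+ 2 - 0))%R; last first.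
      rewrite ab1 subrr mul0r addr0 -ab1 [(_ + b ^+ 2)%R]addrC addrK.
      by field.
    by field.
  - by apply: mFc => //; apply: measurable_funD => //; exact: measurable_funX.
transitivity (`|b|^-1%:E * (`|b|%:E *
    \int[mu]_x \int[mu]_z F (x ^+ 2 + z ^+ 2)%R (a * x + b * z)%R)).
  by rewrite muleA -EFinM mulVf// mul1e.
have mI : measurable_fun setT
    (fun x : R => \int[mu]_z F (x ^+ 2 + z ^+ 2)%R (a * x + b * z)%R).
  apply: measurable_integral2 => //.
  apply: mFc; apply: measurable_funD => //; try exact: measurable_funX.
    exact: measurable_funM.
  exact: measurable_funM.
have mJ : measurable_fun setT (fun p : R => \int[mu]_q F (p ^+ 2 + q ^+ 2)%R p).
  apply: measurable_integral2 => //.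
  by apply: mFc => //; apply: measurable_funD; exact: measurable_funX.
rewrite -ge0_integralZl//; last by move=> x _; exact: integral_ge0.
under eq_integral do rewrite sub1.
rewrite (@fubini_tonelli _ _ _ _ _ mu mu (fun z => K z.1 z.2))//=; last by move=> ?; exact: F0.
under eq_integral do rewrite sub2.
rewrite ge0_integralZl//; last by move=> x _; exact: integral_ge0.
by rewrite muleA -EFinM mulVf// mul1e.
Qed.

End AffineChange.

(** * Volumes of balls and of their central slabs *)

Section BallVolume.
Context {R : realType}.
Local Open Scope ereal_scope.
Local Notation mu := (@lebesgue_measure R).

Lemma vol_ge0 n (E : set (nat -> R)) : 0 <= vol n E.
Proof.
elim: n E => [|n IH] E /=; first by case: ifP.
by apply: integral_ge0 => x _; exact: IH.
Qed.

Lemma vol_mono n (E E' : set (nat -> R)) : E `<=` E' -> vol n E <= vol n E'.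
Proof.
elim: n E E' => [|n IH] E E' EE' /=.
  case: ifPn => [/asboolP/EE' e|_]; first by rewrite ifT//; exact/asboolP.
  by case: ifP.
apply: ge0_le_integralT => [x|x]; first exact: vol_ge0.
by apply: IH => y /=; exact: EE'.
Qed.

Lemma vol_set0 n : vol n (set0 : set (nat -> R)) = 0.
Proof.
elim: n => [|n IH] /=; first by case: ifPn => // /asboolP.
by rewrite -[RHS](integral0 mu setT); apply: eq_integral => x _; exact: IH.
Qed.

Definition ball_vol n (s : R) : \bar R :=
  vol n [set f : nat -> R | \sum_(i < n) f i ^+ 2 <= s]%R.

Lemma ball_vol_ge0 n s : 0 <= ball_vol n s. Proof. exact: vol_ge0. Qed.

Lemma ball_volS n s : ball_vol n.+1 s = \int[mu]_x ball_vol n (s - x ^+ 2)%R.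
Proof.
rewrite /ball_vol /=; apply: eq_integral => x _; congr vol.
apply/seteqP; split => f /=; rewrite big_ord_recl /= => h; lra.
Qed.

Lemma ball_vol_lt0 n s : (s < 0)%R -> ball_vol n s = 0.
Proof.
move=> s0; rewrite -(vol_set0 n); congr vol; apply/seteqP; split => f //=.
move=> fs; have := le_lt_trans fs s0.
by rewrite ltNge sumr_ge0// => i _; exact: sqr_ge0.
Qed.

Lemma ball_vol_mono n s s' : (s <= s')%R -> ball_vol n s <= ball_vol n s'.
Proof. by move=> ss'; apply: vol_mono => f /= h; exact: le_trans ss'. Qed.

Lemma integral_itv_cst (l h : R) (c : \bar R) : (l <= h)%R ->
  \int[mu]_x (if (l <= x <= h)%R then c else 0) = (h - l)%:E * c.
Proof.
move=> lh.
transitivity (\int[mu]_(x in `[l, h]) cst c x).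
  rewrite [RHS]integral_mkcond; apply: eq_integral => x _.
  by rewrite patchE mem_setE in_itv.
by rewrite integral_cst//= lebesgue_measure_itv /= lte_fin muleC; case: ltgtP lh => // ->;
  rewrite subrr.
Qed.

Lemma ball_vol_lty n s : ball_vol n s < +oo.
Proof.
elim: n s => [|n IH] s; first by rewrite /ball_vol /=; case: ifP => _; rewrite ltry.
pose m := (`|s| + 1)%R.
apply: (@le_lt_trans _ _ ((m - - m)%:E * ball_vol n s)).
  rewrite -integral_itv_cst; last by rewrite /m; have := normr_ge0 s; lra.
  rewrite ball_volS; apply: ge0_le_integralT => x; first exact: ball_vol_ge0.
  case: ifPn => xm; first by apply: ball_vol_mono; have := sqr_ge0 x; lra.
  rewrite ball_vol_lt0// subr_lt0 -[(x ^+ 2)%R]real_normK ?num_real//.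
  have mx : (m < `|x|)%R by rewrite ltNge; apply: contra xm; rewrite ler_norml.
  have m1 : (1 <= m)%R by rewrite /m lerDr.
  have sm : (s < m)%R by rewrite /m; have := ler_norm s; lra.
  nra.
by rewrite lte_mul_pinfty// ?lee_fin// /m; have := normr_ge0 s; lra.
Qed.

Lemma ball_vol_fin_num n s : ball_vol n s \is a fin_num.
Proof. by rewrite ge0_fin_numE ?ball_vol_lty ?ball_vol_ge0. Qed.

Lemma measurable_ball_vol n : measurable_fun setT (ball_vol n).
Proof.
have -> : ball_vol n = EFin \o (fine \o ball_vol n).
  by apply/funext => s /=; rewrite fineK ?ball_vol_fin_num.
apply/measurable_EFinP; apply: nondecreasing_measurable => // s s' ss' /=.
by rewrite fine_le ?ball_vol_fin_num// ball_vol_mono.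
Qed.

Lemma ball_vol_scale n (k s : R) : (0 < k)%R ->
  ball_vol n (k ^+ 2 * s)%R = (k ^+ n)%:E * ball_vol n s.
Proof.
move=> k0; elim: n s => [|n IH] s.
  rewrite expr0 mul1e /ball_vol /=; congr (if _ then _ else _).
  by apply: asbool_equiv_eq; rewrite /= !big_ord0 pmulr_rge0// exprn_gt0.
rewrite !ball_volS (@integral_affine _ k 0%R) ?gt_eqF//; last first.
  by move=> x; exact: ball_vol_ge0.
  apply: measurableT_comp (measurable_ball_vol n) _.
  by apply: measurable_funB => //; exact: measurable_funX.
have -> : \int[mu]_x ball_vol n (k ^+ 2 * s - (k * x + 0) ^+ 2)%R =
    \int[mu]_x ((k ^+ n)%:E * ball_vol n (s - x ^+ 2)%R).
  apply: eq_integral => x _; rewrite -IH; congr ball_vol; ring.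
rewrite ge0_integralZl//.
- by rewrite (gtr0_norm k0) muleA -EFinM exprS.
- apply: measurableT_comp (measurable_ball_vol n) _.
  by apply: measurable_funB => //; exact: measurable_funX.
- by move=> x _; exact: ball_vol_ge0.
- by rewrite lee_fin exprn_ge0// ltW.
Qed.

Lemma bernoulli_onem (x : R) n : (0 <= x <= 1)%R ->
  (1 - n%:R * x <= (1 - x) ^+ n)%R.
Proof.
move=> /andP[x0 x1]; elim: n => [|n IH]; first by rewrite mul0r subr0 expr0.
have n0 : (0 <= n%:R :> R)%R by [].
rewrite exprS -natr1; apply: le_trans (ler_wpM2l _ IH); last by lra.
nra.
Qed.

(* The ball contains the cylinder over the concentric ball of radius
   [sqrt (1 - h^2)] and half-height [h] with [h^2 = 1 / (2 (n + 1))]. *)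
Lemma ball_vol_ratio n :
  ball_vol n 1 <= (Num.sqrt n.+1%:R)%:E * ball_vol n.+1 1.
Proof.
set r := (n.+1%:R : R); have r1 : (1 <= r)%R by rewrite ler1n.
pose h := Num.sqrt (2 * r)^-1.
have h0 : (0 <= h)%R by rewrite sqrtr_ge0.
have h2 : (h ^+ 2 = (2 * r)^-1)%R by rewrite sqr_sqrtr// invr_ge0; lra.
have h2r : (h ^+ 2 * (2 * r) = 1)%R by rewrite h2 mulVf// gt_eqF//; lra.
have h2l : (h ^+ 2 <= 1 / 2)%R by nra.
pose k := Num.sqrt (1 - h ^+ 2).
have k2 : (k ^+ 2 = 1 - h ^+ 2)%R by rewrite sqr_sqrtr//; lra.
have k0 : (0 < k)%R by rewrite sqrtr_gt0; lra.
have low : (2 * h * k ^+ n)%:E * ball_vol n 1 <= ball_vol n.+1 1.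
  rewrite EFinM -muleA -ball_vol_scale// mulr1 k2.
  rewrite (_ : 2 * h = h - - h)%R; last by ring.
  rewrite -integral_itv_cst; last by lra.
  rewrite ball_volS; apply: ge0_le_integralT => x.
    by case: ifP => // _; exact: ball_vol_ge0.
  case: ifP => [|_]; last exact: ball_vol_ge0.
  by move=> xh; apply: ball_vol_mono; nra.
apply: le_trans (lee_wpmul2l _ low); last by rewrite lee_fin sqrtr_ge0.
rewrite muleA -EFinM; apply: lee_pemull; first exact: ball_vol_ge0.
rewrite lee_fin -(@ler_pXn2r _ 2)// ?nnegrE//; last first.
  by rewrite !mulr_ge0 ?sqrtr_ge0// exprn_ge0// ltW.
rewrite expr1n exprMn sqr_sqrtr; last by lra.
rewrite !exprMn -exprM mulnC exprM k2.
have bern : (1 - n%:R * h ^+ 2 <= (1 - h ^+ 2) ^+ n)%R.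
  by apply: bernoulli_onem; have := sqr_ge0 h; lra.
have rn : (r = n%:R + 1)%R by rewrite /r -natr1.
have : (1 / 2 <= (1 - h ^+ 2) ^+ n)%R by nra.
set z := ((1 - h ^+ 2) ^+ n)%R; nra.
Qed.

Definition slab_ball n (s c t : R) (a : nat -> R) : set (nat -> R) :=
  [set f | (\sum_(i < n) f i ^+ 2 <= s)%R /\
           (`|c + \sum_(i < n) a i * f i| <= t)%R].

Lemma vol_slab_ballS n s c t a : vol n.+1 (slab_ball n.+1 s c t a) =
  \int[mu]_x vol n (slab_ball n (s - x ^+ 2)%R (c + a 0%N * x)%R t (a \o S)).
Proof.
apply: eq_integral => x _; congr vol; apply/seteqP; split => f;
  rewrite /slab_ball /= !big_ord_recl /= => -[h1]; rewrite addrA => h2; split => //; lra.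
Qed.

(* The slab can be turned so as to be orthogonal to the first axis; in the
   induction step only the plane of the first two coordinates is rotated. *)
Lemma vol_slab_ball n s c t (a : nat -> R) (W : R) : (0 <= W)%R ->
  (W ^+ 2 = \sum_(i < n.+1) a i ^+ 2)%R ->
  vol n.+1 (slab_ball n.+1 s c t a) =
  \int[mu]_p (if (`|c + W * p| <= t)%R then ball_vol n (s - p ^+ 2)%R else 0).
Proof.
pose F m s' c' W' (r p : R) :=
  if (`|c' + W' * p| <= t)%R then ball_vol m (s' - r)%R else 0.
have mF m s' c' W' : measurable_fun setT (fun z : R * R => F m s' c' W' z.1 z.2).
  apply: measurable_fun_ifT.
  - apply: measurable_fun_ler => //; apply: measurableT_comp => //.
    by apply: measurable_funD => //; exact: measurable_funM.
  - by apply: measurableT_comp (measurable_ball_vol m) _; exact: measurable_funB.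
  - exact: measurable_cst.
have F0 m s' c' W' x y : 0 <= F m s' c' W' x y.
  by rewrite /F; case: ifP => // _; exact: ball_vol_ge0.
elim: n s c a W => [|n IH] s c a W W0 W2.
  rewrite vol_slab_ballS.
  have vE s' c' : vol 0 (slab_ball 0 s' c' t (a \o S)) =
      if (`|c'| <= t)%R then ball_vol 0 s' else 0.
    rewrite /ball_vol /slab_ball /= !big_ord0 addr0.
    case: (boolP (`|c'| <= t)%R) => ct; last first.
      by rewrite ifF//; apply/negbTE/asboolPn => -[_]; exact/negP.
    congr (if _ then _ else _); by apply: asbool_equiv_eq; split => [[]|].
  under eq_integral do rewrite vE.
  rewrite big_ord1 in W2; move/eqP: W2; rewrite eqf_sqr => /predU1P[->//|/eqP Wa].
  rewrite [RHS](@integral_affine _ (-1) 0%R) ?oppr_eq0 ?oner_eq0//.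
  - rewrite normrN1 mul1e; apply: eq_integral => x _.
    by rewrite Wa addr0 mulN1r sqrrN mulNr mulrN opprK.
  - exact: (measurableT_comp (mF 0%N s c W) (measurable_fun_pair
      (measurable_funX 2 (@measurable_id _ _ setT)) (@measurable_id _ _ setT))).
  - by move=> x; exact: F0.
pose W' := Num.sqrt (\sum_(i < n.+1) a i.+1 ^+ 2)%R.
have S0 : (0 <= \sum_(i < n.+1) a i.+1 ^+ 2)%R by apply: sumr_ge0 => i _; exact: sqr_ge0.
have W'2 : (W' ^+ 2 = \sum_(i < n.+1) a i.+1 ^+ 2)%R by rewrite sqr_sqrtr.
have {W2}W2 : (W ^+ 2 = a 0%N ^+ 2 + W' ^+ 2)%R by rewrite W2 big_ord_recl W'2.
have [al [be [ab aE bE]]] : exists al be : R,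
    [/\ al ^+ 2 + be ^+ 2 = 1, a 0%N = W * al & W' = W * be]%R.
  have [W_0|Wn0] := eqVneq W 0%R.
    exists 1%R, 0%R; rewrite expr1n expr0n addr0 W_0 !mul0r.
    have a2 := sqr_ge0 (a 0%N); have b2 := sqr_ge0 W'.
    rewrite W_0 expr0n /= in W2.
    split => //; apply/eqP; rewrite -sqrf_eq0; apply/eqP; lra.
  exists (a 0%N / W)%R, (W' / W)%R; split; last 2 first.
  - by rewrite mulrC divfK.
  - by rewrite mulrC divfK.
  - by rewrite !exprMn -mulrDl -W2 exprVn mulfV// sqrf_eq0.
rewrite vol_slab_ballS.
transitivity (\int[mu]_x \int[mu]_z F n s c W (x ^+ 2 + z ^+ 2)%R (al * x + be * z)%R).
  apply: eq_integral => x _; rewrite (IH _ _ _ W') ?sqrtr_ge0//.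
  apply: eq_integral => z _; rewrite /F mulrDr !mulrA -aE -bE addrA.
  by rewrite opprD addrA.
rewrite (rotation_integral (mF n s c W))//.
apply: eq_integral => p _; rewrite /F; case: ifP => _; last exact: integral0.
rewrite ball_volS; apply: eq_integral => q _; congr ball_vol; ring.
Qed.

Lemma vol_slab_ball_le n (t : R) (a : nat -> R) : (0 <= t)%R ->
  (\sum_(i < n.+1) a i ^+ 2 = 1)%R ->
  vol n.+1 (slab_ball n.+1 1 0 t a) <=
  (2 * t * Num.sqrt n.+1%:R)%:E * ball_vol n.+1 1.
Proof.
move=> t0 a1; rewrite (vol_slab_ball _ _ _ (W := 1%R))// ?expr1n//.
apply: (@le_trans _ _ ((t - - t)%:E * ball_vol n 1)).
  rewrite -integral_itv_cst; last by lra.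
  apply: ge0_le_integralT => x.
    by case: ifP => // _; exact: ball_vol_ge0.
  rewrite add0r mul1r ler_norml; case: ifP => // _.
  by apply: ball_vol_mono; have := sqr_ge0 x; lra.
rewrite (_ : t - - t = 2 * t)%R; last by ring.
rewrite [X in _ <= X * _]EFinM -muleA; apply: lee_wpmul2l; first by rewrite lee_fin; lra.
exact: ball_vol_ratio.
Qed.

Lemma ball_vol_gt0 n : 0 < ball_vol n 1.
Proof.
elim: n => [|n IH]; first by rewrite /ball_vol /= ifT//; apply/asboolP; rewrite /= big_ord0.
rewrite lt_neqAle ball_vol_ge0 andbT; apply/eqP => v0.
by have := lt_le_trans IH (ball_vol_ratio n); rewrite -v0 mule0 ltxx.
Qed.

End BallVolume.

Section SphereSlab.
Context {R : realType}.

Lemma enorm_ge0 d (u : 'rV[R]_d) : 0 <= enorm u.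
Proof. exact: sqrtr_ge0. Qed.

Lemma enorm2 d (u : 'rV[R]_d) : enorm u ^+ 2 = dotp u u.
Proof. by rewrite sqr_sqrtr ?dotp_ge0. Qed.

Lemma enormZ d a (u : 'rV[R]_d) : enorm (a *: u) = `|a| * enorm u.
Proof.
by rewrite /enorm dotpZl dotpZr mulrA -expr2 sqrtrM ?sqr_ge0// sqrtr_sqr.
Qed.

Lemma enorm_gt0 d (x : 'rV[R]_d) : x != 0 -> 0 < enorm x.
Proof.
move=> x0; rewrite lt_neqAle enorm_ge0 andbT eq_sym; apply: contra x0 => /eqP nx.
by apply/eqP/dotp_eq0; rewrite -enorm2 nx expr0n.
Qed.

Lemma measurable_rV_coord d (i : 'I_d) :
  measurable_fun setT (fun x : g_sigma_algebraType
    [set A : set 'rV[R]_d | open A] => (x : 'rV[R]_d) ord0 i).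
Proof.
apply: (measurability _ (RGenOpens.measurableE R)) => _ [_ [a [b ->] <-]].
rewrite setTI; apply: sub_sigma_algebra => /=.
by apply: open_comp; [move=> x _; exact: coord_continuous|exact: interval_open].
Qed.

Lemma rV_borel_coord d (i : 'I_d) (B : set R) : measurable B ->
  rV_borel [set x : 'rV[R]_d | B (x ord0 i)].
Proof.
by move=> mB; have := measurable_rV_coord i measurableT mB; rewrite setTI.
Qed.

Lemma rV_borel_dotp d (v : 'rV[R]_d) (B : set R) : measurable B ->
  rV_borel [set x | B (dotp v x)].
Proof.
move=> mB.
have mv : measurable_fun setT (fun x : g_sigma_algebraType
    [set A : set 'rV[R]_d | open A] => dotp v (x : 'rV[R]_d)).
  apply: measurable_sum => i; apply: measurable_funM => //.
  exact: measurable_rV_coord.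
by have := mv measurableT _ mB; rewrite setTI.
Qed.

Lemma sphere_slab_le d (v : 'rV[R]_d) (a : R) : (0 < d)%N -> v != 0 -> 0 <= a ->
  (sphere_measure [set x | (`|dotp v x| <= a)%R]
    <= (2 * (a / enorm v) * Num.sqrt d%:R)%:E)%E.
Proof.
case: d v => // n v _ v0 a0.
have nv0 := enorm_gt0 v0.
pose c (i : nat) := v ord0 (inord i) / enorm v.
have c1 : \sum_(i < n.+1) c i ^+ 2 = 1.
  under eq_bigr do rewrite /c inord_val exprMn.
  rewrite -mulr_suml (_ : \sum_(i < n.+1) _ = enorm v ^+ 2); last first.
    by rewrite enorm2; apply: eq_bigr => i _; rewrite expr2.
  by rewrite exprVn mulfV// sqrf_eq0 gt_eqF.
have cE (f : nat -> R) : \sum_(i < n.+1) c i * f i =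
    dotp v (\row_(i < n.+1) f (nat_of_ord i)) / enorm v.
  rewrite mulr_suml; apply: eq_bigr => i _.
  by rewrite mxE /c inord_val mulrAC.
have ballE : lvol [set u : 'rV[R]_n.+1 | enorm u <= 1] = ball_vol n.+1 1.
  rewrite /lvol /ball_vol; congr vol; apply/seteqP; split => f /=.
  - move=> h; have := h; rewrite -(@ler_pXn2r _ 2)// ?nnegrE ?enorm_ge0//.
    rewrite enorm2 expr1n; apply: le_trans.
    by apply: ler_sum => i _; rewrite !mxE expr2.
  - move=> h; rewrite -(@ler_pXn2r _ 2)// ?nnegrE ?enorm_ge0//.
    rewrite enorm2 expr1n; apply: le_trans h.
    by apply: ler_sum => i _; rewrite !mxE expr2.
have coneE : (lvol (sphere_cone [set x : 'rV[R]_n.+1 | (`|dotp v x| <= a)%R])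
    <= vol n.+1 (slab_ball n.+1 1 0 (a / enorm v) c))%E.
  apply: vol_mono => f [t [x [/andP[t0 t1] /= vx x1 fE]]]; split.
    have : dotp (t *: x) (t *: x) <= 1.
      rewrite dotpZl dotpZr -enorm2 x1 expr1n mulr1 -expr2.
      by rewrite expr_le1// ltW.
    by rewrite -fE; apply: le_trans; apply: ler_sum => i _; rewrite !mxE expr2.
  rewrite add0r cE fE dotpZr normrM normfV (gtr0_norm nv0) ler_pM2r ?invr_gt0//.
  rewrite normrM (gtr0_norm t0); apply: le_trans vx.
  by rewrite ler_piMl.
rewrite /sphere_measure ballE.
have b0 := @ball_vol_gt0 R n.+1.
have bfin := @ball_vol_fin_num R n.+1 1.
have fb0 : 0 < fine (@ball_vol R n.+1 1).
  by rewrite -lte_fin fineK.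
apply: (@le_trans _ _ ((2 * (a / enorm v) * Num.sqrt n.+1%:R)%:E *
   ball_vol n.+1 1 * ((fine (ball_vol n.+1 1))^-1)%:E)%E).
  apply: lee_wpmul2r; first by rewrite lee_fin invr_ge0 ltW.
  apply: le_trans coneE _; apply: vol_slab_ball_le => //.
  by rewrite divr_ge0// ltW.
rewrite -{1}(fineK bfin) -!EFinM lee_fin -!mulrA mulfV ?gt_eqF// mulr1.
by rewrite !mulrA.
Qed.

End SphereSlab.

(** * Independent sigma-algebras *)

Section Independence.
Context {R : realType} {dsp : measure_display} {T : measurableType dsp}.
Variables (P : probability T R) (I : finType) (F : I -> set (set T)).

Definition joint_events (J : {set I}) : set (set T) :=
  [set X | exists2 A : I -> set T, (forall i, i \in J -> F i (A i)) &
                                   X = [set w | forall i, i \in J -> A i w]].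

Definition joint_sigma (J : {set I}) : set (set T) := <<s joint_events J >>.

Hypothesis F_T : forall i, F i setT.
Hypothesis F_I : forall i, setI_closed (F i).
Hypothesis F_measurable : forall i, F i `<=` measurable.
Hypothesis F_indep : forall (J : {set I}) (A : I -> set T),
  (forall i, i \in J -> F i (A i)) ->
  P [set w | forall i, i \in J -> A i w] = (\prod_(i in J) P (A i))%E.

Lemma joint_eventsI J : setI_closed (joint_events J).
Proof.
move=> _ _ [A FA ->] [B FB ->]; exists (fun i => A i `&` B i).
  by move=> i iJ; apply: F_I; [exact: FA|exact: FB].
apply/seteqP; split => w /=; first by move=> [hA hB] i iJ; split; [exact: hA|exact: hB].
by move=> h; split => i /h[].
Qed.

Lemma joint_events_measurable J : joint_events J `<=` measurable.
Proof.
move=> _ [A FA ->].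
have -> : [set w | forall i, i \in J -> A i w] =
    \bigcap_(i in [set i | i \in J]) A i by [].
rewrite bigcap_mkcond; apply: fin_bigcap_measurable => // i _.
by case: ifPn => // /set_mem iJ; apply: F_measurable; exact: FA.
Qed.

Lemma joint_eventsT J : joint_events J setT.
Proof. by exists (fun=> setT) => //; apply/seteqP; split. Qed.

Lemma joint_events_sub (J : {set I}) i A : i \in J -> F i A -> joint_events J A.
Proof.
move=> iJ FA; exists (fun k => if k == i then A else setT).
  by move=> k _; case: eqP => [->|_].
apply/seteqP; split => w /=; first by move=> Aw k _; case: eqP.
by move=> /(_ _ iJ); rewrite eqxx.
Qed.

Lemma joint_sigma_sub (J : {set I}) i A : i \in J -> F i A -> joint_sigma J A.
Proof. by move=> iJ FA; apply: sub_sigma_algebra; exact: joint_events_sub FA. Qed.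

Lemma joint_sigma_measurable J : joint_sigma J `<=` measurable.
Proof.
apply: smallest_sub; first exact: sigma_algebra_measurable.
exact: joint_events_measurable.
Qed.

Lemma joint_sigma_mono (J J' : {set I}) : J \subset J' -> joint_sigma J `<=` joint_sigma J'.
Proof.
move=> JJ'; apply: smallest_sub; first exact: smallest_sigma_algebra.
move=> _ [A FA ->]; apply: sub_sigma_algebra.
exists (fun i => if i \in J then A i else setT).
  by move=> i _; case: ifP => // /FA.
apply/seteqP; split => w /=; first by move=> h i _; case: ifP => // /h.
by move=> h i iJ; have := h i (fintype.subsetP JJ' _ iJ); rewrite iJ.
Qed.

Lemma indep_extend (G : set (set T)) B :
  G `<=` measurable -> setI_closed G -> G setT -> measurable B ->
  (forall A, G A -> P (A `&` B) = P A * P B)%E ->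
  forall A, <<s G >> A -> (P (A `&` B) = P A * P B)%E.
Proof.
move=> Gm GI GT mB GB A sA.
have [r r0 PBE] : exists2 r : R, 0 <= r & P B = r%:E.
  by exists (fine (P B)); rewrite ?fine_ge0// fineK// fin_num_measure.
have cover : \bigcup_(k : nat) [set: T] = setT.
  by apply/seteqP; split => // w _; exists 0%N.
have uniq := @g_sigma_algebra_measure_unique _ _ _ G Gm (fun=> setT) (fun=> GT) cover
  (mrestr P mB) (mscale (NngNum r0) P) GI.
rewrite [LHS](uniq _ _ A sA).
- by rewrite [RHS]muleC PBE.
- by move=> A' GA'; rewrite [LHS]GB// muleC PBE.
- move=> _; change (P (setT `&` B) < +oo)%E.
  by rewrite setTI PBE ltry.
Qed.

Lemma joint_sigma_indep (J J' : {set I}) A B : fintype.disjoint (mem J) (mem J') ->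
  joint_sigma J A -> joint_sigma J' B -> (P (A `&` B) = P A * P B)%E.
Proof.
move=> JJ' sA sB.
have ev A' B' : joint_events J A' -> joint_events J' B' -> (P (A' `&` B') = P A' * P B')%E.
  move=> [X FX ->] [Y FY ->].
  pose Z i := if i \in J then X i else Y i.
  have nJ i : i \in J' -> (i \in J) = false.
    by move=> iJ'; apply/negbTE; rewrite (disjointFl JJ').
  have -> : [set w | forall i, i \in J -> X i w] `&` [set w | forall i, i \in J' -> Y i w] =
      [set w | forall i, i \in J :|: J' -> Z i w].
    apply/seteqP; split => w /=.
      move=> [hX hY] i; rewrite inE /Z; case: ifPn => [/hX//|iJ] /=; exact: hY.
    move=> h; split => i iJ; have := h i; rewrite inE /Z iJ ?orbT.
      by apply.
    by rewrite nJ//; apply.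
  rewrite !F_indep//; last first.
    move=> i; rewrite inE /Z; case: ifPn => [/FX//|iJ] /=; exact: FY.
  rewrite (eq_bigl [in [predU J & J']]); last by move=> i; rewrite !inE.
  rewrite bigU//=; congr (_ * _)%E; apply: eq_bigr => i iJ; rewrite /Z ?iJ//.
  by rewrite nJ.
apply: (@indep_extend (joint_events J)) sA.
- exact: joint_events_measurable.
- exact: joint_eventsI.
- exact: joint_eventsT.
- exact: joint_sigma_measurable sB.
move=> A' eA'; rewrite setIC muleC.
apply: (@indep_extend (joint_events J')) sB.
- exact: joint_events_measurable.
- exact: joint_eventsI.
- exact: joint_eventsT.
- exact: joint_events_measurable eA'.
by move=> B' eB'; rewrite setIC muleC ev.
Qed.

Definition sigma_type (J : {set I}) := g_sigma_algebraType (joint_events J).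

Lemma measurable_to_sigma J :
  measurable_fun setT (fun w : T => w : sigma_type J).
Proof. by move=> _ B mB; rewrite setTI; exact: (@joint_sigma_measurable J B mB). Qed.

Definition to_sigma J : {mfun T >-> sigma_type J} :=
  HB.pack (fun w : T => w : sigma_type J)
    (isMeasurableFun.Build _ _ _ _ _ (@measurable_to_sigma J)).

(* By independence the law of [w |-> (w, w)] on the product of the two
   sigma-algebras is a product measure, which can be integrated by sections. *)
Lemma indep_fubini_le (J J' : {set I}) (A : set T)
    (C : set (sigma_type J * sigma_type J')) (s : R) :
  fintype.disjoint (mem J) (mem J') -> joint_sigma J A -> measurable C -> 0 <= s ->
  (forall w, A w -> P [set w' | C (w, w')] <= s%:E)%E ->
  (P (A `&` [set w | C (w, w)]) <= s%:E * P A)%E.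
Proof.
move=> JJ' sA mC s0 Cs.
pose m1 := distribution P (to_sigma J).
pose m2 := distribution P (to_sigma J').
pose diag (w : T) : sigma_type J * sigma_type J' := (w, w).
have mdiag : measurable_fun setT diag.
  exact: measurable_fun_pair (@measurable_to_sigma J) (@measurable_to_sigma J').
pose X : set (sigma_type J * sigma_type J') := ((A : set (sigma_type J)) `*` setT) `&` C.
have mX : measurable X.
  apply: measurableI mC.
  exact: (@measurableX _ _ (sigma_type J) (sigma_type J') A setT sA measurableT).
have uniq := @product_measure_unique _ _ _ _ R m1 m2 (pushforward P diag).
have m12 A1 A2 : measurable A1 -> measurable A2 ->
    pushforward P diag (A1 `*` A2) = (m1 A1 * m2 A2)%E.
  move=> mA1 mA2; rewrite /pushforward -[RHS](joint_sigma_indep JJ' mA1 mA2).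
  by congr (P _).
have -> : A `&` [set w | C (w, w)] = diag @^-1` X.
  by apply/seteqP; split => w /= => [[Aw Cw]|[[Aw _] Cw]].
rewrite -[X in (X <= _)%E](uniq mdiag m12 X mX) /product_measure1.
apply: (@le_trans _ _ (\int[m1]_w (s%:E * (\1_(A : set (sigma_type J)) w)%:E))%E).
  apply: ge0_le_integralT => w; first exact: measure_ge0.
  rewrite /= indicE; have [/set_mem Aw|Aw] := boolP (w \in A).
    rewrite mule1; apply: le_trans (Cs w Aw).
    have mCw : measurable (xsection C w) by exact: measurable_xsection.
    have mXw : measurable (xsection X w) by exact: measurable_xsection.
    have -> : P [set w' | C (w, w')] = m2 (xsection C w).
      by congr (P _); apply/seteqP; split => w' /=; rewrite xsectionE.
    apply: le_measure; rewrite ?inE//.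
    by move=> w'; rewrite !xsectionE /= => -[].
  rewrite mule0 (_ : xsection X w = set0) ?measure0//.
  apply/seteqP; split => w' //; rewrite xsectionE => -[[/= Aw' _] _].
  by move: Aw; rewrite mem_set.
rewrite ge0_integralZl//; last exact/measurable_EFinP/measurable_indic.
by rewrite integral_indic// setIT.
Qed.

End Independence.

(** * Measurability of the vertices *)

Section MeasurableVertex.
Context {R : realType} {dsp : measure_display} {T : measurableType dsp}.

Lemma measurable_invr : measurable_fun [set: R] (fun x : R => x^-1).
Proof.
have -> : [set: R] = [set x | x != 0] `|` [set 0].
  by apply/seteqP; split => x // _; case: (eqVneq x 0) => h; [right|left].
have oD : open [set x : R | x != 0].
  by rewrite (_ : [set x | _] = ~` [set 0]) ?openC; [exact: closed_eq|
    apply/seteqP; split => x /= /eqP].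
apply/measurable_funU => //; first exact: open_measurable.
split; last exact: measurable_fun_set1.
apply: open_continuous_measurable_fun => // x; rewrite inE /= => x0.
exact: inv_continuous.
Qed.

Definition mx_measurable m n (A : T -> 'M[R]_(m, n)) :=
  forall i j, measurable_fun setT (fun w => A w i j).

Lemma mx_measurable_mul m n p (A : T -> 'M[R]_(m, n)) (B : T -> 'M[R]_(n, p)) :
  mx_measurable A -> mx_measurable B -> mx_measurable (fun w => A w *m B w).
Proof.
move=> mA mB i j.
have -> : (fun w => (A w *m B w) i j) = fun w => \sum_k A w i k * B w k j.
  by apply/funext => w; rewrite mxE.
by apply: measurable_sum => k; exact: measurable_funM.
Qed.

Lemma mx_measurable_det n (A : T -> 'M[R]_n) :
  mx_measurable A -> measurable_fun setT (fun w => \det (A w)).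
Proof.
move=> mA; apply: measurable_sum => s; apply: measurable_funM => //.
by apply: measurable_prod => i _; exact: mA.
Qed.

Lemma mx_measurable_inv n (A : T -> 'M[R]_n) :
  mx_measurable A -> mx_measurable (fun w => invmx (A w)).
Proof.
move=> mA i j; have mdet := mx_measurable_det mA.
have -> : (fun w => invmx (A w) i j) = fun w =>
    if \det (A w) == 0 then A w i j
    else (\det (A w))^-1 * cofactor (A w) j i.
  apply/funext => w; rewrite /invmx unitmxE unitfE; case: eqP => //= _.
  by rewrite !mxE.
apply: measurable_fun_ifT.
- by apply: measurable_fun_eqr.
- exact: mA.
- apply: measurable_funM.
    exact: measurableT_comp measurable_invr mdet.
  apply: measurable_funM => //; apply: mx_measurable_det => k l.
  have -> : (fun w => row' j (col' i (A w)) k l) = fun w => A w (lift j k) (lift i l).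
    by apply/funext => w; rewrite !mxE.
  exact: mA.
Qed.

Lemma mx_measurable_slab_vertex d N (e : 'rV[R]_d) (t : R) (F : T -> 'M[R]_(N, d))
    (lo hi : T -> 'I_N -> R) (tau : {ffun 'I_N -> option bool}) :
  (forall n j, tau n != None -> measurable_fun setT (fun w => F w n j)) ->
  (forall n, tau n != None -> measurable_fun setT (fun w => lo w n)) ->
  (forall n, tau n != None -> measurable_fun setT (fun w => hi w n)) ->
  mx_measurable (fun w => slab_vertex e (F w) t tau (lo w) (hi w)).
Proof.
move=> mF mlo mhi.
have mrow : mx_measurable (fun w => row_mask (tau_index tau) (col_mx e (F w))).
  move=> i j; have -> : (fun w => row_mask (tau_index tau) (col_mx e (F w)) i j) =
      fun w => if i \in tau_index tau then col_mx e (F w) i j else 0.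
    by apply/funext => w; rewrite mxE.
  case: (split_ordP i) => k ->.
    rewrite tau_index_lshift (_ : (fun w => _) = cst (e k j))//.
    by apply/funext => w; rewrite col_mxEu.
  rewrite tau_index_rshift; case: (boolP (tau k != None)) => // kt.
  rewrite (_ : (fun w => _) = (fun w => F w k j)); last first.
    by apply/funext => w; rewrite col_mxEd.
  exact: mF.
have mside : mx_measurable (fun w => row_mx t%:M (slab_side (lo w) (hi w) tau)).
  move=> i j; case: (split_ordP j) => k ->.
    rewrite (_ : (fun w => _) = cst ((t%:M : 'M[R]_1) i k))//.
    by apply/funext => w; rewrite row_mxEl.
  rewrite (_ : (fun w => _) = (fun w => slab_side (lo w) (hi w) tau i k)); last first.
    by apply/funext => w; rewrite row_mxEr.
  rewrite (_ : (fun w => _) = (fun w =>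
    if tau k is Some b then if b then hi w k else lo w k else 0)); last first.
    by apply/funext => w; rewrite mxE.
  case tk : (tau k) => [[]|]//.
    by apply: mhi; rewrite tk.
  by apply: mlo; rewrite tk.
apply: mx_measurable_mul => //; apply: mx_measurable_mul => //.
apply: mx_measurable_inv => i j.
rewrite (_ : (fun w => _) = (fun w =>
   (row_mask (tau_index tau) (col_mx e (F w)) *m
    (row_mask (tau_index tau) (col_mx e (F w)))^T) i j +
   diag_mx (\row_i (i \notin tau_index tau)%:R) i j)); last first.
  by apply/funext => w; rewrite /gram mxE.
apply: measurable_funD => //; apply: mx_measurable_mul => // k l.
rewrite (_ : (fun w => _) = (fun w => row_mask (tau_index tau) (col_mx e (F w)) l k))//.
by apply/funext => w; rewrite mxE.
Qed.

End MeasurableVertex.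

(** * Survival of a vertex chosen by independent data *)

Section Model.
Context {R : realType} {dsp : measure_display} {T : measurableType dsp}.
Variables (P : probability T R) (d N : nat) (delta : R).
Variables (phi : 'I_N -> T -> 'rV[R]_d) (eps : 'I_N -> T -> R).
Hypothesis hmodel : model P delta phi eps.
Hypothesis delta_gt0 : 0 < delta.
Hypothesis d_gt0 : (0 < d)%N.

Let F := event_family phi eps.

Lemma event_familyT i : F i setT.
Proof.
case: i => n; exists setT; rewrite ?preimage_setT//.
have [_ + _] := smallest_sigma_algebra setT [set A : set 'rV[R]_d | open A].
move=> /(_ set0); rewrite setD0; apply.
by have [+ _ _] := smallest_sigma_algebra setT [set A : set 'rV[R]_d | open A].
Qed.

Lemma event_familyI i : setI_closed (F i).
Proof.
case: i => n _ _ [A mA ->] [B mB ->]; exists (A `&` B); rewrite ?preimage_setI//.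
  exact: (@measurableI _ (g_sigma_algebraType [set A : set 'rV[R]_d | open A])).
exact: measurableI.
Qed.

Lemma event_family_measurable i : F i `<=` measurable.
Proof.
have [mphi meps _ _ _] := hmodel.
case: i => n _ [A mA ->]; first exact: mphi.
by rewrite -[X in measurable X]setTI; exact: meps.
Qed.

Lemma event_family_indep (J : {set 'I_N + 'I_N}) (A : 'I_N + 'I_N -> set T) :
  (forall i, i \in J -> F i (A i)) ->
  P [set w | forall i, i \in J -> A i w] = (\prod_(i in J) P (A i))%E.
Proof. by have [_ _ indep _ _] := hmodel; exact: indep. Qed.

Definition data_index (S : {set 'I_N}) : {set 'I_N + 'I_N} :=
  [set i | match i with inl n => n \in S | inr n => n \in S end].

Definition data_sigma (S : {set 'I_N}) : set (set T) :=
  joint_sigma F (data_index S).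

Definition data_type (S : {set 'I_N}) := sigma_type F (data_index S).

Lemma data_index_disjoint (S S' : {set 'I_N}) :
  (forall n, n \in S -> n \in S' -> False) ->
  fintype.disjoint (mem (data_index S)) (mem (data_index S')).
Proof.
move=> SS'; apply/pred0P => -[] n /=; rewrite !inE; apply/negP => /andP[nS nS'];
  exact: SS' nS nS'.
Qed.

Lemma data_sigma_mono (S S' : {set 'I_N}) : S \subset S' ->
  data_sigma S `<=` data_sigma S'.
Proof.
move=> SS'; apply: joint_sigma_mono; first exact: event_familyT.
by apply/fintype.subsetP => -[] n; rewrite !inE => /(fintype.subsetP SS').
Qed.

Lemma data_sigma_measurable S : data_sigma S `<=` measurable.
Proof. apply: joint_sigma_measurable; exact: event_family_measurable. Qed.

Lemma data_measurable_mono (S S' : {set 'I_N}) (f : T -> R) : S \subset S' ->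
  measurable_fun setT (f : data_type S -> R) ->
  measurable_fun setT (f : data_type S' -> R).
Proof.
move=> SS' mf _ B mB; rewrite setTI; apply: (data_sigma_mono SS').
by have := mf measurableT B mB; rewrite setTI.
Qed.

Lemma data_measurable_phi (S : {set 'I_N}) n i : n \in S ->
  measurable_fun setT (fun w : data_type S => phi n w ord0 i).
Proof.
move=> nS _ B mB; rewrite setTI.
apply: (joint_sigma_sub event_familyT (i := inl n)); first by rewrite inE.
by exists [set x : 'rV[R]_d | B (x ord0 i)] => //; exact: rV_borel_coord.
Qed.

Lemma data_measurable_eps (S : {set 'I_N}) n : n \in S ->
  measurable_fun setT (fun w : data_type S => eps n w).
Proof.
move=> nS _ B mB; rewrite setTI.
apply: (joint_sigma_sub event_familyT (i := inr n)); first by rewrite inE.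
by exists B.
Qed.

Definition relevant (a : R) n (w : T) : bool := delta - a <= `|eps n w|.

(* The [n]th datum [w'] does not rule out the point [v], when only the data with
   [|eps_n| >= delta - a] are taken into account. *)
Definition survives (a : R) n (v : 'rV[R]_d) (w : T) : bool :=
  relevant a n w ==> (`|dotp v (phi n w) - eps n w| <= delta).

Lemma measurable_relevant (S : {set 'I_N}) a n : n \in S ->
  measurable_fun setT (fun w : data_type S => relevant a n w).
Proof.
move=> nS; apply: measurable_fun_ler => //; apply: measurableT_comp => //.
exact: data_measurable_eps.
Qed.

Lemma measurable_survives (S S' : {set 'I_N}) a n (v : T -> 'rV[R]_d) :
  n \in S' ->
  (forall i, measurable_fun setT (fun w : data_type S => v w ord0 i)) ->
  measurable_fun setT (fun z : data_type S * data_type S' =>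
    survives a n (v z.1) z.2).
Proof.
move=> nS' mv.
have -> : (fun z : data_type S * data_type S' => survives a n (v z.1) z.2) =
  fun z => ~~ relevant a n z.2 || (`|dotp (v z.1) (phi n z.2) - eps n z.2| <= delta).
  by apply/funext => z; rewrite /survives implybE.
apply: measurable_or.
  apply: measurable_neg; exact: measurableT_comp (measurable_relevant a nS') _.
apply: measurable_fun_ler => //; apply: measurableT_comp => //.
apply: measurable_funB; last first.
  exact: measurableT_comp (data_measurable_eps nS') (@measurable_snd _ _ _ _).
apply: measurable_sum => i; apply: measurable_funM.
  exact: measurableT_comp (mv i) (@measurable_fst _ _ _ _).
exact: measurableT_comp (data_measurable_phi i nS') (@measurable_snd _ _ _ _).
Qed.

Lemma measurable_survives_diag (S : {set 'I_N}) a n (v : T -> 'rV[R]_d) :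
  n \in S ->
  (forall i, measurable_fun setT (fun w : data_type S => v w ord0 i)) ->
  data_sigma S [set w | survives a n (v w) w].
Proof.
move=> nS mv; have ms := measurable_survives a nS mv.
have mdiag : measurable_fun setT (fun w : data_type S => (w, w)).
  exact: measurable_fun_pair.
have := measurableT_comp ms mdiag => /(_ measurableT [set true] Logic.I).
by rewrite setTI.
Qed.

Lemma survives_iter (S U : {set 'I_N}) a (v : T -> 'rV[R]_d) (A : set T) (s : R) :
  (forall n, n \in S -> n \in U -> False) ->
  (forall i, measurable_fun setT (fun w : data_type S => v w ord0 i)) ->
  data_sigma S A -> 0 <= s ->
  (forall w n, A w -> n \in U -> P [set w' | survives a n (v w) w'] <= s%:E)%E ->
  data_sigma (S :|: U) (A `&` [set w | forall n, n \in U -> survives a n (v w) w])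
  /\ (P (A `&` [set w | forall n, n \in U -> survives a n (v w) w])
      <= (s ^+ #|U|)%:E * P A)%E.
Proof.
move=> SU mv sA s0 As.
elim: {U}#|U| {-2}U (erefl #|U|) SU As => [|k IH] U Uk SU As.
  have -> : U = finset.set0 by apply/eqP; rewrite -cards_eq0 Uk.
  rewrite (_ : A `&` _ = A).
    by rewrite finset.setU0 cards0 expr0 mul1e; split.
  by apply/seteqP; split => w /=; [case|move=> Aw; split=> // n; rewrite inE].
have /card_gt0P[n nU] : (0 < #|U|)%N by rewrite Uk.
pose V := U :\ n; have Vk : #|V| = k.
  by have := cardsD1 n U; rewrite nU Uk add1n => -[].
have VU m : m \in V -> m \in U by rewrite inE => /andP[].
have [] := IH V Vk.
- by move=> m mS /VU; exact: SU.
- by move=> w m Aw /VU; exact: As.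
set E := A `&` _ => sE PE.
have EU : A `&` [set w | forall n, n \in U -> survives a n (v w) w] =
    E `&` [set w | survives a n (v w) w].
  apply/seteqP; split => w /= [].
    by move=> Aw h; split; [split=> // m /VU; exact: h|exact: h].
  move=> [Aw h] sn; split=> // m mU; have [->//|mn] := eqVneq m n.
  by apply: h; rewrite !inE mn.
have nSV : n \notin S :|: V.
  by rewrite !inE eqxx /= orbF; apply/negP => /SU; apply.
split.
  rewrite EU; apply: (@measurableI _ (data_type (S :|: U)) E).
    apply: data_sigma_mono sE; apply: finset.setUS.
    by apply/fintype.subsetP => m /VU.
  apply: measurable_survives_diag; first by rewrite inE nU orbT.
  by move=> i; apply: data_measurable_mono (mv i); exact: finset.subsetUl.
rewrite Vk in PE; rewrite EU Uk exprS.
have disj : fintype.disjoint (mem (data_index (S :|: V))) (mem (data_index (finset.set1 n))).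
  by apply: data_index_disjoint => m mSV; rewrite inE => /eqP mn; move: nSV; rewrite -mn mSV.
have mv' i : measurable_fun setT (fun w : data_type (S :|: V) => v w ord0 i).
  by apply: data_measurable_mono (mv i); exact: finset.subsetUl.
have mC : measurable [set z : data_type (S :|: V) * data_type (finset.set1 n) |
    survives a n (v z.1) z.2].
  have := measurable_survives a (finset.set11 n) mv' => /(_ measurableT [set true] Logic.I).
  by rewrite setTI.
apply: le_trans (indep_fubini_le event_familyT event_familyI event_family_measurable
  event_family_indep disj sE mC s0 _) _.
  by move=> w [Aw _] /=; exact: As.
rewrite EFinM -muleA; apply: lee_wpmul2l; first by rewrite lee_fin.
exact: PE.
Qed.

End Model.

Section ModelBounds.
Context {R : realType} {dsp : measure_display} {T : measurableType dsp}.
Variables (P : probability T R) (d N : nat) (delta : R).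
Variables (phi : 'I_N -> T -> 'rV[R]_d) (eps : 'I_N -> T -> R).
Hypothesis hmodel : model P delta phi eps.
Hypothesis delta_gt0 : 0 < delta.
Hypothesis d_gt0 : (0 < d)%N.

Let F := event_family phi eps.

Lemma eps_measurable n (B : set R) : measurable B -> measurable (eps n @^-1` B).
Proof.
have [_ meps _ _ _] := hmodel.
by move=> mB; rewrite -[X in measurable X]setTI; exact: meps.
Qed.

Lemma eps_prob_itv n (l h : R) : - delta <= l -> l <= h -> h <= delta ->
  P (eps n @^-1` `[l, h]%classic) = ((h - l) / (2 * delta))%:E.
Proof.
have [_ _ _ _ peps] := hmodel; move=> dl lh hd; rewrite peps//.
rewrite (_ : `[l, h]%classic `&` _ = `[l, h]%classic); last first.
  apply/seteqP; split => x /=; rewrite in_itv /=; first by case.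
  by move=> /andP[lx xh]; split=> //; apply/andP; split; lra.
rewrite lebesgue_measure_itv /= lte_fin; case: ifPn => [_|hl].
  by rewrite -EFinD -EFinM.
have -> : l = h by apply/eqP; rewrite eq_le lh leNgt.
by rewrite subrr mul0r mul0e.
Qed.

Definition eps_escapes n : set T := [set w | delta < `|eps n w|].

Lemma measurable_eps_escapes n : measurable (eps_escapes n).
Proof.
have [_ meps _ _ _] := hmodel.
have := measurable_fun_ltr (@measurable_cst _ _ T R setT delta)
  (measurableT_comp (@normr_measurable R setT) (meps n)).
by move=> /(_ measurableT [set true] Logic.I); rewrite setTI.
Qed.

Lemma eps_escapes0 n : P (eps_escapes n) = 0%E.
Proof.
have [_ _ _ _ peps] := hmodel.
pose B : set R := ~` `[- delta, delta]%classic.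
have -> : eps_escapes n = eps n @^-1` B.
  apply/seteqP; split => w; rewrite /eps_escapes /B /= in_itv /= -ler_norml.
    by rewrite ltNge => /negP.
  by move/negP; rewrite -ltNge.
rewrite peps; last exact: measurableC.
rewrite (_ : B `&` _ = set0) ?measure0 ?mul0e//.
by apply/seteqP; split => x //=; rewrite /B /= in_itv => -[].
Qed.

Lemma measurable_normr_ge (a : R) : measurable [set x : R | a <= `|x|].
Proof.
have := measurable_fun_ler (@measurable_cst _ _ R R setT a) (@normr_measurable R setT).
by move=> /(_ measurableT [set true] Logic.I); rewrite setTI.
Qed.

Lemma measurable_normr_le (a : R) : measurable [set x : R | `|x| <= a].
Proof.
have := measurable_fun_ler (@normr_measurable R setT) (@measurable_cst _ _ R R setT a).
by move=> /(_ measurableT [set true] Logic.I); rewrite setTI.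
Qed.

Lemma relevant_prob a n : 0 <= a <= delta ->
  (P [set w | relevant delta eps a n w] <= (a / delta)%:E)%E.
Proof.
move=> /andP[a0 ad].
pose B1 : set R := `[- delta, - delta + a]%classic.
pose B2 : set R := `[delta - a, delta]%classic.
have mB1 := eps_measurable n (measurable_itv _ : measurable B1).
have mB2 := eps_measurable n (measurable_itv _ : measurable B2).
have mE := measurable_eps_escapes n.
apply: (@le_trans _ _ (P ((eps n @^-1` B1 `|` eps n @^-1` B2) `|` eps_escapes n))).
  apply: le_measure; rewrite ?inE.
  - exact: (eps_measurable n (measurable_normr_ge (delta - a))).
  - by do 2 apply: measurableU => //.
  move=> w; rewrite /relevant /= => rw.
  case: (ltP delta `|eps n w|) => [?|]; first by right.
  rewrite ler_norml => /andP[dl dh]; left.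
  move: rw; rewrite ler_normr => /orP[h|h]; [right|left];
    rewrite /B1 /B2 /= in_itv /=;
    apply/andP; split => //; lra.
rewrite measureU0//; [|exact: measurableU|exact: eps_escapes0].
apply: (@le_trans _ _ (P (eps n @^-1` B1) + P (eps n @^-1` B2))%E).
  exact: measureU2.
rewrite !eps_prob_itv; [|lra..].
rewrite -EFinD lee_fin le_eqVlt; apply/orP; left; apply/eqP; field.
by rewrite gt_eqF.
Qed.

Lemma data_relevant_prob a (S : {set 'I_N}) : 0 <= a <= delta ->
  data_sigma phi eps S [set w | forall n, n \in S -> relevant delta eps a n w] /\
  (P [set w | forall n, n \in S -> relevant delta eps a n w]
    <= ((a / delta) ^+ #|S|)%:E)%E.
Proof.
move=> ad; pose J : {set 'I_N + 'I_N} := inr @: S.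
pose A (i : 'I_N + 'I_N) : set T := match i with
  | inl _ => setT | inr n => [set w | relevant delta eps a n w] end.
have FA i : F i (A i).
  case: i => n; first exact: event_familyT.
  by exists [set x : R | delta - a <= `|x|] => //; exact: measurable_normr_ge.
have E : [set w | forall n, n \in S -> relevant delta eps a n w] =
    [set w | forall i, i \in J -> A i w].
  apply/seteqP; split => w /= h.
    by move=> i /imsetP[n nS ->]; exact: h.
  by move=> n nS; have := h (inr n); apply; apply: imset_f.
rewrite E; split.
  apply: sub_sigma_algebra; exists (fun i => if i \in J then A i else setT).
    by move=> i _; case: ifP => _; [exact: FA|exact: event_familyT].
  apply/seteqP; split => w /= h i.
    by move=> _; case: ifP => // /h.
  move=> /[dup] iJ /imsetP[n nS iE]; have := h i; rewrite iJ; apply.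
  by rewrite iE inE.
rewrite (event_family_indep hmodel); last by move=> i _; exact: FA.
rewrite big_imset /=; last by move=> m n _ _ [].
have a0 : 0 <= a / delta by case/andP: ad => a0 _; rewrite divr_ge0// ltW.
rewrite -prodr_const -prodEFin.
apply: (@proj2 (0 <= \prod_(n in S) P [set w | relevant delta eps a n w])%E).
elim/big_rec2: _ => [|n x y nS [y0 yx]]; first by rewrite lee01 lexx.
split; first exact: mule_ge0.
by apply: lee_pmul => //; exact: relevant_prob.
Qed.

End ModelBounds.

Section SurvivalBounds.
Context {R : realType} {dsp : measure_display} {T : measurableType dsp}.
Variables (P : probability T R) (d N : nat) (delta : R).
Variables (phi : 'I_N -> T -> 'rV[R]_d) (eps : 'I_N -> T -> R).
Hypothesis hmodel : model P delta phi eps.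
Hypothesis delta_gt0 : 0 < delta.
Hypothesis d_gt0 : (0 < d)%N.

Lemma phi_measurable n (v : 'rV[R]_d) (B : set R) : measurable B ->
  measurable [set w | B (dotp v (phi n w))].
Proof.
by have [mphi _ _ _ _] := hmodel; move=> /(rV_borel_dotp v) /(mphi n).
Qed.

Lemma slab_prob n (v : 'rV[R]_d) (a t : R) : 0 < t -> t <= enorm v -> 0 <= a ->
  (P [set w | (`|dotp v (phi n w)| <= a)%R] <= (2 * (a / t) * Num.sqrt d%:R)%:E)%E.
Proof.
have [_ _ _ pphi _] := hmodel; move=> t0 tv a0.
have v0 : v != 0.
  apply: contraTneq (lt_le_trans t0 tv) => ->.
  rewrite -leNgt /enorm (_ : dotp 0 0 = 0) ?sqrtr0//.
  by rewrite -(scale0r (0 : 'rV[R]_d)) dotpZl mul0r.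
have mB : rV_borel [set x | `|dotp v x| <= a].
  exact: rV_borel_dotp (measurable_normr_le a).
rewrite (_ : [set w | _] = phi n @^-1` [set x | `|dotp v x| <= a])//.
rewrite pphi//; apply: le_trans (sphere_slab_le d_gt0 v0 a0) _.
rewrite lee_fin ler_wpM2r ?sqrtr_ge0// ler_pM2l//.
by rewrite ler_wpM2l// lef_pV2 ?posrE// (lt_le_trans t0).
Qed.

Lemma measurable_survives_cst a n (v : 'rV[R]_d) :
  measurable [set w | survives delta phi eps a n v w].
Proof.
apply: (data_sigma_measurable hmodel (S := finset.set1 n)).
apply: (@measurable_survives_diag _ _ _ _ _ delta phi eps _ a n (fun=> v)); rewrite ?inE//.
Qed.

Lemma survives_prob_far n (v : 'rV[R]_d) (t : R) : 0 < t -> t <= enorm v ->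
  (P [set w | survives delta phi eps delta n v w]
    <= (4 * delta * Num.sqrt d%:R / t)%:E)%E.
Proof.
move=> t0 tv.
have mB := measurable_normr_le (2 * delta).
have mE := measurable_eps_escapes hmodel n.
apply: (@le_trans _ _ (P ([set w | (`|dotp v (phi n w)| <= 2 * delta)%R]
    `|` eps_escapes delta eps n))).
  apply: le_measure; rewrite ?inE.
  - exact: measurable_survives_cst.
  - by apply: measurableU => //; exact: (@phi_measurable n v _ mB).
  move=> w; rewrite /survives /relevant /= subrr normr_ge0 /= => sw.
  case: (ltP delta `|eps n w|) => [?|ed]; first by right.
  left; rewrite (_ : dotp v (phi n w) = dotp v (phi n w) - eps n w + eps n w); last by ring.
  by rewrite (le_trans (ler_normD _ _))// mulr_natl mulr2n lerD.
rewrite measureU0//; last first.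
- exact: eps_escapes0 hmodel n.
- exact: (@phi_measurable n v _ mB).
have d20 : 0 <= 2 * delta by rewrite mulr_ge0// ltW.
apply: le_trans (slab_prob n t0 tv d20) _.
by rewrite lee_fin le_eqVlt; apply/orP; left; apply/eqP; ring.
Qed.

Lemma kill_prob n (v : 'rV[R]_d) (B B' : set R) : measurable B -> measurable B' ->
  P ([set w | B (dotp v (phi n w))] `&` eps n @^-1` B') =
  (P [set w | B (dotp v (phi n w))] * P (eps n @^-1` B'))%E.
Proof.
move=> mB mB'.
pose F := event_family phi eps.
apply: (joint_sigma_indep (@event_familyT _ _ _ _ _ phi eps) (@event_familyI _ _ _ _ _ phi eps)
  (event_family_measurable hmodel) (event_family_indep hmodel)
  (J := finset.set1 (inl n)) (J' := finset.set1 (inr n))).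
- by rewrite disjoints1 inE.
- apply: (joint_sigma_sub (@event_familyT _ _ _ _ _ phi eps) (i := inl n)); rewrite ?inE//.
  by exists [set x | B (dotp v x)] => //; exact: rV_borel_dotp.
- apply: (joint_sigma_sub (@event_familyT _ _ _ _ _ phi eps) (i := inr n)); rewrite ?inE//.
  by exists B'.
Qed.

Lemma survives_prob_near n (v : 'rV[R]_d) (t a : R) : 0 < t -> t <= enorm v ->
  a = t / (4 * Num.sqrt d%:R) -> a <= delta ->
  (P [set w | survives delta phi eps a n v w] <= (1 - a / delta / 4)%:E)%E.
Proof.
move=> t0 tv aE ad.
have sd0 : 0 < Num.sqrt d%:R :> R by rewrite sqrtr_gt0 ltr0n.
have a0 : 0 < a by rewrite aE divr_gt0// mulr_gt0.
pose Bp : set R := [set x | a < x]; pose Bm : set R := [set x | x < - a].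
pose Bs : set R := [set x | `|x| <= a].
have mBp : measurable Bp.
  by rewrite (_ : Bp = `]a, +oo[%classic)//; apply/seteqP; split => x;
    rewrite /Bp /= in_itv /= andbT.
have mBm : measurable Bm.
  by rewrite (_ : Bm = `]-oo, (- a)[%classic)//; apply/seteqP; split => x;
    rewrite /Bm /= in_itv.
have mBs : measurable Bs by exact: measurable_normr_le.
pose Il : set R := `[- delta, - delta + a]%classic.
pose Ir : set R := `[delta - a, delta]%classic.
have mIl : measurable Il by exact: measurable_itv.
have mIr : measurable Ir by exact: measurable_itv.
pose ev (B : set R) := [set w | B (dotp v (phi n w))].
have mev B : measurable B -> measurable (ev B) by exact: phi_measurable.
pose Kp := ev Bp `&` eps n @^-1` Il; pose Km := ev Bm `&` eps n @^-1` Ir.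
have mKp : measurable Kp by apply: measurableI; [exact: mev|exact: (eps_measurable hmodel)].
have mKm : measurable Km by apply: measurableI; [exact: mev|exact: (eps_measurable hmodel)].
have qp : P (eps n @^-1` Il) = (a / (2 * delta))%:E.
  by rewrite (eps_prob_itv hmodel)//; [congr EFin; congr (_ / _); ring|lra..].
have qm : P (eps n @^-1` Ir) = (a / (2 * delta))%:E.
  by rewrite (eps_prob_itv hmodel)//; [congr EFin; congr (_ / _); ring|lra..].
have half : (P (ev Bs) <= (1 / 2)%:E)%E.
  apply: le_trans (slab_prob n t0 tv (ltW a0)) _; rewrite lee_fin le_eqVlt; apply/orP; left.
  by apply/eqP; rewrite aE; field; rewrite !gt_eqF.
have disj : Kp `&` Km = set0.
  apply/seteqP; split => w //= -[[/= h1 _] [/= h2 _]].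
  by move: h1 h2; rewrite /ev /Bp /Bm /=; lra.
have PK : P (Kp `|` Km) = ((P (ev Bp) + P (ev Bm)) * (a / (2 * delta))%:E)%E.
  transitivity (P Kp + P Km)%E; first exact: measureU.
  rewrite ge0_muleDl// -{1}qp -qm.
  by congr (_ + _)%E; exact: kill_prob.
have tot : (1%:E = P (ev Bs) + (P (ev Bp) + P (ev Bm)))%E.
  transitivity (P (ev Bs `|` (ev Bp `|` ev Bm))); last first.
    transitivity (P (ev Bs) + P (ev Bp `|` ev Bm))%E.
      apply: measureU; [exact: mev|by apply: measurableU; exact: mev|].
      apply/seteqP; split => w //= -[]; rewrite /ev /Bp /Bm /Bs /= ler_norml.
      by move=> /andP[h1 h2] [|]; lra.
    congr (_ + _)%E; apply: measureU; [exact: mev|exact: mev|].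
    by apply/seteqP; split => w //= -[]; rewrite /ev /Bp /Bm /=; lra.
  rewrite -(probability_setT P); congr (P _); apply/seteqP; split => w // _.
  rewrite /ev /Bp /Bm /Bs /= ler_norml.
  by case: (ltP a (dotp v (phi n w))) => h1; [right; left|
    case: (ltP (dotp v (phi n w)) (- a)) => h2; [right; right|left; apply/andP; split]].
have surv_sub : [set w | survives delta phi eps a n v w] `<=` ~` (Kp `|` Km).
  move=> w /= sw; move: sw; rewrite /survives /relevant => /implyP sw.
  case=> -[/=]; rewrite /ev /Bp /Bm /Il /Ir /= in_itv /= => h1 /andP[h2 h3].
    have := sw _; rewrite ler_normr ler_norml => h; have := h ltac:(apply/orP; right; lra).
    by move=> /andP[]; lra.
  have := sw _; rewrite ler_normr ler_norml => h; have := h ltac:(apply/orP; left; lra).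
  by move=> /andP[]; lra.
apply: (@le_trans _ _ (P (~` (Kp `|` Km)))).
  apply: le_measure; rewrite ?inE//; first exact: measurable_survives_cst.
  by apply: measurableC; exact: measurableU.
rewrite probability_setC; last exact: measurableU.
rewrite PK.
have fin B : measurable B -> exists p : R, P (ev B) = p%:E.
  by move=> mB; exists (fine (P (ev B))); rewrite fineK// fin_num_measure//; exact: mev.
have [p0 p0E] := fin _ mBs; have [p1 p1E] := fin _ mBp; have [p2 p2E] := fin _ mBm.
move: tot half; rewrite p0E p1E p2E -!EFinD => -[tot]; rewrite lee_fin => half.
change ((1%:E - (p1 + p2)%:E * (a / (2 * delta))%:E <= (1 - a / delta / 4)%:E)%E).
rewrite -EFinM -EFinB lee_fin.
have x2 : 1 / 2 <= p1 + p2 by lra.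
have -> : a / (2 * delta) = a / delta / 2 by field; rewrite gt_eqF.
have : 0 < a / delta by rewrite divr_gt0.
set r := a / delta => r0.
nra.
Qed.

End SurvivalBounds.

(** * Union bound over the vertices *)

Section VertexUnionBound.
Context {R : realType} {dsp : measure_display} {T : measurableType dsp}.

Lemma measure_bigU_le (P : {measure set T -> \bar R}) (I : Type) (r : seq I)
    (Q : pred I) (B : I -> set T) : (forall i, measurable (B i)) ->
  (P (\big[setU/set0]_(i <- r | Q i) B i) <= \sum_(i <- r | Q i) P (B i))%E.
Proof.
move=> mB.
apply: (@proj2 (measurable (\big[setU/set0]_(i <- r | Q i) B i))).
elim/big_rec2: _ => [|i y x Qi [mx xy]]; first by rewrite measure0.
split; first exact: measurableU.
by apply: le_trans (measureU2 _ (mB i) mx) _; exact: leeD2l.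
Qed.

Lemma bigU_mem (I : finType) (Q : pred I) (B : I -> set T) i w : Q i -> B i w ->
  (\big[setU/set0]_(i | Q i) B i) w.
Proof. by move=> Qi Bw; rewrite (bigD1 i)//=; left. Qed.

Lemma dotp_le_enorm d (u e : 'rV[R]_d) : enorm e = 1 -> dotp u e <= enorm u.
Proof.
move=> e1; have e2 : dotp e e = 1 by rewrite -enorm2 e1 expr1n.
have := dotp_ge0 (u - dotp u e *: e).
rewrite dotpBl dotpZl !(dotpC _ (u - _)) !dotpBl !dotpZl e2 (dotpC e u).
rewrite -enorm2 => h.
case: (leP (dotp u e) 0) => [h0|h0]; first exact: le_trans (enorm_ge0 u).
rewrite -(@ler_pXn2r _ 2)// ?nnegrE ?enorm_ge0 ?(ltW h0)//; nra.
Qed.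

Variables (P : probability T R) (d N : nat) (delta : R).
Variables (phi : 'I_N -> T -> 'rV[R]_d) (eps : 'I_N -> T -> R).
Hypothesis hmodel : model P delta phi eps.
Hypothesis delta_gt0 : 0 < delta.

Definition data_matrix (w : T) : 'M[R]_(N, d) := \matrix_(n, j) phi n w ord0 j.

Definition data_vertex (e : 'rV[R]_d) (t : R) (tau : {ffun 'I_N -> option bool}) (w : T) :=
  slab_vertex e (data_matrix w) t tau (fun n => eps n w - delta) (fun n => eps n w + delta).

Lemma row_data_matrix w n : row n (data_matrix w) = phi n w.
Proof. by apply/rowP => j; rewrite !mxE. Qed.

Lemma measurable_data_vertex e t tau i :
  measurable_fun setT (fun w : data_type phi eps (tau_supp tau) =>
    data_vertex e t tau w ord0 i).
Proof.
apply: (@mx_measurable_slab_vertex _ _ (data_type phi eps (tau_supp tau)) d N e t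
  data_matrix (fun w n => eps n w - delta) (fun w n => eps n w + delta) tau) => n.
- move=> j nt; rewrite (_ : (fun w => _) = (fun w => phi n w ord0 j)); last first.
    by apply/funext => w; rewrite mxE.
  by apply: data_measurable_phi; rewrite inE.
- move=> nt; apply: measurable_funB => //.
  by apply: data_measurable_eps; rewrite inE.
- move=> nt; apply: measurable_funD => //.
  by apply: data_measurable_eps; rewrite inE.
Qed.

Definition vertex_event (e : 'rV[R]_d) (t a : R) (tau : {ffun 'I_N -> option bool}) :=
  ([set w | forall n, n \in tau_supp tau -> relevant delta eps a n w]
    `&` [set w | dotp (data_vertex e t tau w) e = t])
  `&` [set w | forall n, n \in ~: tau_supp tau ->
                 survives delta phi eps a n (data_vertex e t tau w) w].

Lemma vertex_event_prob e t a s tau : enorm e = 1 -> 0 <= a <= delta -> 0 <= s ->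
  (forall n v, t <= enorm v ->
     (P [set w | survives delta phi eps a n v w] <= s%:E)%E) ->
  measurable (vertex_event e t a tau) /\
  (P (vertex_event e t a tau) <=
    ((a / delta) ^+ #|tau_supp tau| * s ^+ (N - #|tau_supp tau|))%:E)%E.
Proof.
move=> e1 ad s0 hs; set S := tau_supp tau.
have [sR PR] := data_relevant_prob hmodel delta_gt0 S ad.
set Rel := [set w | forall n, n \in S -> relevant delta eps a n w] in sR PR *.
pose v := data_vertex e t tau.
have mv i : measurable_fun setT (fun w : data_type phi eps S => v w ord0 i).
  exact: measurable_data_vertex.
pose Te := [set w | dotp (v w) e = t].
have sTe : data_sigma phi eps S Te.
  have mdot : measurable_fun setT (fun w : data_type phi eps S => dotp (v w) e).
    by apply: measurable_sum => i; exact: measurable_funM.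
  have := mdot measurableT [set t] (measurable_set1 t).
  by rewrite setTI.
have sA : data_sigma phi eps S (Rel `&` Te).
  exact: (@measurableI _ (data_type phi eps S)).
have SU n : n \in S -> n \in ~: S -> False by move=> nS; rewrite finset.in_setC nS.
have bound w n : (Rel `&` Te) w -> n \in ~: S ->
    (P [set w' | survives delta phi eps a n (v w) w'] <= s%:E)%E.
  by move=> [_ vt] _; apply: hs; rewrite -vt; exact: dotp_le_enorm.
have [sE PE] := survives_iter hmodel SU mv sA s0 bound.
split; first exact: (data_sigma_measurable hmodel sE).
apply: le_trans PE _; rewrite cardsCs finset.setCK card_ord mulrC EFinM.
apply: lee_wpmul2l; first by rewrite lee_fin exprn_ge0.
apply: le_trans PR; apply: le_measure; rewrite ?inE.
- exact: (data_sigma_measurable hmodel sA).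
- exact: (data_sigma_measurable hmodel sR).
- exact: subIsetl.
Qed.

Lemma vertex_event_cover (e x : 'rV[R]_d) (t a : R) w : enorm e = 1 -> 0 < t ->
  (forall n, `|eps n w| <= delta) -> PN delta phi eps w x -> t <= dotp x e ->
  exists2 tau, (#|tau_supp tau| < d)%N & vertex_event e t a tau w.
Proof.
move=> e1 t0 hE hx tx; have xe0 : 0 < dotp x e by exact: lt_le_trans tx.
pose k := t / dotp x e.
have k01 : 0 <= k <= 1.
  apply/andP; split; first by rewrite divr_ge0 ?(ltW t0) ?(ltW xe0).
  by rewrite ler_pdivrMr// mul1r.
have e0 : e != 0.
  apply: contraTneq xe0 => ->; rewrite -(scale0r e) dotpZr mul0r ltxx//.
have kxe : dotp (k *: x) e = t by rewrite dotpZl /k divfK// gt_eqF.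
have kslab n : relevant delta eps a n w ->
    eps n w - delta <= dotp (k *: x) (row n (data_matrix w)) <= eps n w + delta.
  move=> _; rewrite row_data_matrix dotpZl.
  have := hx n; have := hE n; rewrite !ler_norml => /andP[e2 e3] /andP[h1 h2].
  have -> : k * dotp x (phi n w) = 0 + k * (dotp x (phi n w) - 0) by ring.
  by apply: convex_slab => //; apply/andP; split; lra.
have [tau [tr td te ts]] := slab_vertex_exists e0 kxe kslab.
exists tau => //; split; first split => //.
  by move=> n; rewrite inE => /tr.
move=> n _ /=; apply/implyP => rn; have := ts n rn.
by rewrite row_data_matrix -/(data_vertex _ _ _ _) ler_norml => /andP[h1 h2];
  apply/andP; split; lra.
Qed.

Lemma vertex_union_bound (K : finType) (e : K -> 'rV[R]_d) (t a s : R) :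
  (forall k, enorm (e k) = 1) -> 0 < t -> 0 <= a <= delta -> 0 <= s ->
  (forall n v, t <= enorm v ->
     (P [set w | survives delta phi eps a n v w] <= s%:E)%E) ->
  exists B : set T, [/\ measurable B,
    (P B <= (#|K|%:R * \sum_(tau : {ffun 'I_N -> option bool} | (#|tau_supp tau| < d)%N)
        (a / delta) ^+ #|tau_supp tau| * s ^+ (N - #|tau_supp tau|))%:E)%E,
    forall w x k, PN delta phi eps w x -> t <= dotp x (e k) -> B w &
    forall w n, delta < `|eps n w| -> B w].
Proof.
move=> e1 t0 ad s0 hs.
pose Q (tau : {ffun 'I_N -> option bool}) := (#|tau_supp tau| < d)%N.
pose Bk k := \big[setU/set0]_(tau | Q tau) vertex_event (e k) t a tau.
pose null := \big[setU/set0]_(n < N) eps_escapes delta eps n.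
have mV k tau : measurable (vertex_event (e k) t a tau).
  by have [] := vertex_event_prob tau (e1 k) ad s0 hs.
have mBk k : measurable (Bk k) by apply: bigsetU_measurable => tau _; exact: mV.
have mU : measurable (\big[setU/set0]_k Bk k) by apply: bigsetU_measurable.
have mesc n : measurable (eps_escapes delta eps n) by exact: measurable_eps_escapes hmodel n.
have mnull : measurable null by apply: bigsetU_measurable.
have null0 : P null = 0%E.
  apply/eqP; rewrite eq_le measure_ge0 andbT.
  apply: le_trans (measure_bigU_le _ _ _ mesc) _.
  by rewrite big1// => n _; exact: eps_escapes0 hmodel n.
exists ((\big[setU/set0]_k Bk k) `|` null); split.
- exact: measurableU.
- rewrite measureU0//; apply: le_trans (measure_bigU_le _ _ _ mBk) _.
  rewrite -sum1_card natr_sum mulr_suml -sumEFin; apply: lee_sum => k _.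
  rewrite mul1r; apply: le_trans (measure_bigU_le _ _ _ (mV k)) _.
  rewrite -sumEFin; apply: lee_sum => tau _.
  by have [] := vertex_event_prob tau (e1 k) ad s0 hs.
- move=> w x k hx tx; have [/forallP hE|] := boolP [forall n, `|eps n w| <= delta].
    left; have [tau Qtau Vw] := vertex_event_cover a (e1 k) t0 hE hx tx.
    by apply: (@bigU_mem _ xpredT _ k) => //; apply: bigU_mem Vw.
  rewrite negb_forall => /existsP[n]; rewrite -ltNge => hn; right.
  by apply: (@bigU_mem _ xpredT _ n).
- by move=> w n hn; right; apply: (@bigU_mem _ xpredT _ n).
Qed.

(* Weighting each tight constraint by [y] removes the restriction on the number
   of tight constraints, and the sum over [tau] then factorizes. *)
Lemma tau_sum_le (d' : nat) (rho s y : R) : 0 <= rho -> 0 <= s -> 1 <= y ->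
  \sum_(tau : {ffun 'I_N -> option bool} | (#|tau_supp tau| < d'.+1)%N)
     rho ^+ #|tau_supp tau| * s ^+ (N - #|tau_supp tau|)
  <= y ^+ d' * (s + 2 * (rho / y)) ^+ N.
Proof.
move=> r0 s0 y1; have y0 : 0 < y by lra.
pose W (b : option bool) := if b is Some _ then rho / y else s.
have W0 b : 0 <= W b by case: b => [_|] //=; rewrite divr_ge0// ltW.
have WE (tau : {ffun 'I_N -> option bool}) :
    \prod_n W (tau n) = (rho / y) ^+ #|tau_supp tau| * s ^+ (N - #|tau_supp tau|).
  rewrite (bigID (mem (tau_supp tau)))/=; congr (_ * _).
    rewrite (eq_bigr (fun=> rho / y)) ?prodr_const// => n.
    by rewrite inE /W; case: (tau n).
  rewrite (eq_bigr (fun=> s)) => [|n]; last by rewrite inE negbK => /eqP ->.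
  rewrite prodr_const; congr (_ ^+ _).
  have := cardsC (tau_supp tau); rewrite card_ord => /(congr1 (subn^~ #|tau_supp tau|)).
  by rewrite addKn => <-; apply: eq_card => n; rewrite finset.in_setC.
have -> : s + 2 * (rho / y) = \sum_b W b.
  rewrite (bigD1 None)//= (bigD1 (Some true))//= (bigD1 (Some false))//= big1.
    by rewrite addr0; ring.
  by case=> [[]|].
rewrite -[N in leRHS]card_ord -prodr_const bigA_distr_bigA /= mulr_sumr.
rewrite [leRHS](bigID (fun tau : {ffun 'I_N -> option bool} => (#|tau_supp tau| < d'.+1)%N)) /=.
rewrite ler_wpDr//.
  by apply: sumr_ge0 => tau _; rewrite mulr_ge0 ?exprn_ge0 ?prodr_ge0// ltW.
apply: ler_sum => tau Qtau; rewrite WE mulrA; apply: ler_wpM2r; first exact: exprn_ge0.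
rewrite expr_div_n mulrCA -[leLHS]mulr1; apply: ler_wpM2l; first exact: exprn_ge0.
rewrite -(subnK (_ : #|tau_supp tau| <= d')%N)// exprD mulfK ?expf_neq0 ?gt_eqF//.
exact: exprn_ege1.
Qed.

End VertexUnionBound.

(** * Finite families of directions *)

Section Directions.
Context {R : realType}.

Definition axis d (k : 'I_d * bool) : 'rV[R]_d := (-1) ^+ k.2 *: delta_mx ord0 k.1.

Lemma dotp_axis d (x : 'rV[R]_d) k : dotp x (axis k) = (-1) ^+ k.2 * x ord0 k.1.
Proof.
rewrite dotpZr; congr (_ * _); rewrite /dotp (bigD1 k.1)//= big1 => [|i ik].
  by rewrite mxE !eqxx mulr1 addr0.
by rewrite mxE eqxx (negbTE ik) mulr0.
Qed.

Lemma enorm_axis d (k : 'I_d * bool) : enorm (axis k) = 1.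
Proof.
rewrite /enorm dotp_axis mxE mxE !eqxx mulr1 -expr2 sqrr_sign.
exact: sqrtr1.
Qed.

Lemma axis_cover d (x : 'rV[R]_d) : (0 < d)%N ->
  exists k, enorm x / Num.sqrt d%:R <= dotp x (axis k).
Proof.
move=> d0; pose i0 := Ordinal d0.
case: (@Order.TotalTheory.arg_maxP _ _ _ i0 xpredT (fun i => `|x ord0 i|) isT) => m _ hm.
exists (m, x ord0 m < 0); rewrite dotp_axis /=.
have -> : (-1) ^+ (x ord0 m < 0)%R * x ord0 m = `|x ord0 m| by rewrite -normrEsign.
rewrite ler_pdivrMr ?sqrtr_gt0 ?ltr0n//.
rewrite -(@ler_pXn2r _ 2)// ?nnegrE ?enorm_ge0 ?mulr_ge0 ?sqrtr_ge0//.
rewrite enorm2 exprMn sqr_sqrtr// mulr_natr.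
have -> : `|x ord0 m| ^+ 2 *+ d = \sum_(i < d) `|x ord0 m| ^+ 2.
  by rewrite sumr_const card_ord.
apply: ler_sum => i _; rewrite -expr2 -(real_normK (num_real (x ord0 i))).
by rewrite lerXn2r ?nnegrE//; exact: hm.
Qed.

Definition digit d := ('I_(4 * d).+1 * bool)%type.

Definition int_vec d (z : {ffun 'I_d -> digit d}) : 'rV[R]_d :=
  \row_i ((-1) ^+ (z i).2 * (z i).1%:R).

Definition small_int_vec d (z : {ffun 'I_d -> digit d}) : bool :=
  (int_vec z != 0) && (\sum_(i < d) (z i).1 <= 4 * d)%N.

Definition net_index d := {z : {ffun 'I_d -> digit d} | small_int_vec z}.

Definition net d (k : net_index d) : 'rV[R]_d :=
  (enorm (int_vec (val k)))^-1 *: int_vec (val k).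

Lemma enorm_net d (k : net_index d) : enorm (net k) = 1.
Proof.
have /andP[z0 _] := valP k; have nz := enorm_gt0 z0.
by rewrite enormZ ger0_norm ?invr_ge0 ?ltW// mulVf// gt_eqF.
Qed.

Lemma sum_pow_half n : \sum_(k < n) (1 / 2 : R) ^+ k <= 2.
Proof.
suff : \sum_(k < n) (1 / 2 : R) ^+ k + 2 * (1 / 2) ^+ n = 2.
  by have := exprn_ge0 n (_ : 0 <= 1 / 2 :> R) => /(_ ltac:(lra)); lra.
elim: n => [|n IH]; first by rewrite big_ord0 expr0; lra.
by rewrite big_ord_recr /= exprS -[RHS]IH; field.
Qed.

Lemma card_net d : (#|{: net_index d}|%:R <= 64 ^+ d :> R).
Proof.
rewrite card_sig -sum1_card natr_sum.
pose wt (b : digit d) : R := 16 * (1 / 2) ^+ (nat_of_ord b.1).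
have wt0 b : 0 <= wt b by rewrite mulr_ge0// exprn_ge0//; lra.
apply: (@le_trans _ _ (\sum_(z : {ffun 'I_d -> digit d}) \prod_i wt (z i))).
  rewrite [leRHS](bigID (@small_int_vec d)) /= ler_wpDr//.
    by apply: sumr_ge0 => z _; apply: prodr_ge0.
  apply: ler_sum => z /andP[_ zd].
  rewrite big_split /= prodr_const card_ord prodrXr.
  have -> : 16 ^+ d = 2 ^+ (4 * d) :> R by rewrite exprM; congr (_ ^+ _); ring.
  rewrite div1r exprVn -[X in X <= _]/1 -ler_pdivrMr ?invr_gt0 ?exprn_gt0//.
  by rewrite invrK mul1r ler_eXn2l//; lra.
rewrite -(bigA_distr_bigA (fun (_ : 'I_d) b => wt b)) prodr_const card_ord.
apply: lerXn2r; rewrite ?nnegrE//; first exact: sumr_ge0.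
rewrite -(pair_big xpredT xpredT (fun k b => wt (k, b))) /=.
under eq_bigr do rewrite /wt /= sumr_const card_bool.
rewrite sumrMnl -mulr_sumr -mulr_natr.
have := sum_pow_half (4 * d).+1; lra.
Qed.

(* Truncate the coordinates of [x] rescaled to norm [2 sqrt d] towards [0]; the
   bound on the inner product is [X (X - 1) >= 3/4 X^2 - 1]. *)
Lemma net_cover d (x : 'rV[R]_d) : (0 < d)%N -> x != 0 ->
  exists k : net_index d, enorm x / 2 <= dotp x (net k).
Proof.
move=> d0 x0; have nx := enorm_gt0 x0.
have sd0 : 0 < Num.sqrt d%:R :> R by rewrite sqrtr_gt0 ltr0n.
pose c : R := 2 * Num.sqrt d%:R / enorm x.
have c0 : 0 < c by rewrite divr_gt0// mulr_gt0.
pose X := c *: x.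
have X2 : dotp X X = 4 * d%:R.
  rewrite dotpZl dotpZr -enorm2 /c.
  rewrite -[d%:R in RHS]sqr_sqrtr ?ler0n//; field; by rewrite gt_eqF.
have X2s : \sum_i X ord0 i ^+ 2 = 4 * d%:R by rewrite -X2.
pose m i := Num.truncn `|X ord0 i|.
have mX i : (m i)%:R <= `|X ord0 i| < (m i).+1%:R by exact: truncn_itv.
have m2s : \sum_i ((m i)%:R : R) ^+ 2 <= 4 * d%:R.
  rewrite -X2s; apply: ler_sum => i _; rewrite -(real_normK (num_real (X ord0 i))).
  by rewrite lerXn2r ?nnegrE//; case/andP: (mX i).
have ms : (\sum_i m i <= 4 * d)%N.
  rewrite -(ler_nat R) natr_sum natrM; apply: le_trans m2s; apply: ler_sum => i _.
  by case: (m i) => [|k]; rewrite ?expr0n// expr2 ler_peMl// ler1n.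
have mi i : (m i < (4 * d).+1)%N.
  by rewrite ltnS (leq_trans _ ms)// (bigD1 i)//= leq_addr.
pose z : {ffun 'I_d -> digit d} := [ffun i => (Ordinal (mi i), X ord0 i < 0)].
have zE i : int_vec z ord0 i = (-1) ^+ (X ord0 i < 0)%R * (m i)%:R.
  by rewrite mxE ffunE.
have zn : enorm (int_vec z) <= 2 * Num.sqrt d%:R.
  rewrite -(@ler_pXn2r _ 2)// ?nnegrE ?enorm_ge0 ?mulr_ge0 ?sqrtr_ge0//.
  rewrite enorm2 exprMn sqr_sqrtr// (_ : 2 ^+ 2 = 4)//; last by ring.
  apply: le_trans m2s; apply: ler_sum => i _; rewrite zE -expr2 exprMn.
  by rewrite sqrr_sign mul1r.
have Xz : 2 * d%:R <= dotp X (int_vec z).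
  have -> : 2 * d%:R = \sum_(i < d) (3 / 4 * X ord0 i ^+ 2 - 1).
    by rewrite sumrB -mulr_sumr X2s sumr_const card_ord; field.
  apply: ler_sum => i _; rewrite zE [leRHS]mulrCA [leRHS]mulrA -normrEsign.
  have /andP[_] := mX i; rewrite -natr1 => h.
  rewrite -(real_normK (num_real (X ord0 i))).
  have := normr_ge0 (X ord0 i); set y := `|_| in h * => y0.
  have : 0 <= y * ((m i)%:R + 1 - y) by rewrite mulr_ge0//; lra.
  have := sqr_ge0 (y / 2 - 1); lra.
have dR : 0 < d%:R :> R by rewrite ltr0n.
have z0 : int_vec z != 0.
  apply: contraTneq Xz => ->; rewrite -(scale0r X) dotpZr mul0r -ltNge; lra.
have sz : small_int_vec z.
  rewrite /small_int_vec z0 /=; under eq_bigr do rewrite ffunE; exact: ms.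
exists (Sub z sz); rewrite /net SubK dotpZr.
have nz := enorm_gt0 z0.
have xz : dotp x (int_vec z) = dotp X (int_vec z) / c.
  by rewrite dotpZl mulrAC mulfV ?mul1r// gt_eqF.
rewrite xz [leRHS]mulrC ler_pdivlMr//.
apply: (@le_trans _ _ (enorm x / 2 * (2 * Num.sqrt d%:R))).
  by rewrite ler_wpM2l// divr_ge0// ltW.
rewrite ler_pdivlMr// /c.
have -> : enorm x / 2 * (2 * Num.sqrt d%:R) * (2 * Num.sqrt d%:R / enorm x) =
    2 * Num.sqrt d%:R ^+ 2 by field; rewrite gt_eqF.
by rewrite sqr_sqrtr.
Qed.

End Directions.

(** * Dyadic bound of a second moment *)

Section SecondMoment.
Context {R : realType}.
Local Open Scope ereal_scope.

Definition dyadic_sum (r : R) (b : nat -> bool) : \bar R :=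
  \sum_(j <oo) (4 ^+ j.+1 * r ^+ 2 * (b j)%:R)%:E.

Lemma dyadic_coef_ge0 (r : R) j : (0 <= 4 ^+ j * r ^+ 2)%R.
Proof. by rewrite mulr_ge0 ?sqr_ge0. Qed.

Lemma dyadic_sum_ge0 r b : 0 <= dyadic_sum r b.
Proof. by apply: nneseries_ge0 => j _ _; rewrite lee_fin mulr_ge0 ?dyadic_coef_ge0. Qed.

Lemma dyadic_sum_ge_term r (b : nat -> bool) j : b j ->
  (4 ^+ j.+1 * r ^+ 2)%:E <= dyadic_sum r b.
Proof.
move=> bj; pose f i := (4 ^+ i.+1 * r ^+ 2 * (b i)%:R)%:E : \bar R.
have f0 i : 0 <= f i by rewrite lee_fin mulr_ge0 ?dyadic_coef_ge0.
apply: (@le_trans _ _ (\sum_(0 <= i < j.+1) f i)).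
  rewrite big_nat_recr//= /f bj mulr1; apply: leeDr.
  by apply: sume_ge0 => i _; exact: f0.
exact: nneseries_lim_ge.
Qed.

Lemma sqr_le_dyadic_sum (r : R) (W : \bar R) (b : nat -> bool) : (0 < r)%R ->
  r%:E < W -> (forall j, (2 ^+ j * r)%:E < W -> b j) -> W ^+ 2 <= dyadic_sum r b.
Proof.
move=> r0; case: W => [x rW hb|rW hb|//]; last first.
  rewrite (_ : +oo ^+ 2 = +oo); last by rewrite expe2 mulyy.
  rewrite leye_eq; apply/eqP/eqyP => A A0.
  have [j hj] : exists j, (A <= 4 ^+ j.+1 * r ^+ 2)%R.
    exists (Num.truncn (A / r ^+ 2)).
    rewrite -ler_pdivrMr ?exprn_gt0//; set y := (A / r ^+ 2)%R.
    have := truncnS_gt y => h; apply: (le_trans (ltW h)).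
    have : ((Num.truncn y).+1 <= 4 ^ (Num.truncn y).+1)%N by exact/ltnW/ltn_expl.
    by rewrite -(ler_nat R) natrX.
  apply: le_trans (dyadic_sum_ge_term r (hb j (ltry _))).
  by rewrite lee_fin.
rewrite lte_fin in rW.
have ex : exists n, (x <= 2 ^+ n * r)%R.
  exists (Num.truncn (x / r)).+1.
  rewrite -ler_pdivrMr//; set y := (x / r)%R.
  have := truncnS_gt y => h; apply: (le_trans (ltW h)).
  have : ((Num.truncn y).+1 <= 2 ^ (Num.truncn y).+1)%N by exact/ltnW/ltn_expl.
  by rewrite -(ler_nat R) natrX.
case: (ex_minnP ex) => -[|n] xn hn.
  by move: xn; rewrite expr0 mul1r leNgt rW.
have nx : (2 ^+ n * r < x)%R by rewrite ltNge; apply/negP => /hn; rewrite ltnn.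
apply: le_trans (dyadic_sum_ge_term r (hb n _)); last by rewrite lte_fin.
rewrite -EFin_expe lee_fin.
have -> : (4 ^+ n.+1 * r ^+ 2 = (2 ^+ n.+1 * r) ^+ 2)%R.
  by rewrite exprMn -exprM mulnC exprM; congr (_ ^+ _ * _)%R; ring.
by rewrite lerXn2r ?nnegrE// ?mulr_ge0 ?exprn_ge0// ltW// (lt_trans r0).
Qed.

Context {dsp : measure_display} {T : measurableType dsp}.
Variable P : probability T R.

Lemma measurable_scaled_indic (c : R) (B : set T) : measurable B ->
  measurable_fun setT (fun w => (c * (w \in B)%:R)%:E).
Proof.
move=> mB; apply/measurable_EFinP; apply: measurable_funM => //.
by have := @measurable_indic _ T R setT _ mB.
Qed.

Lemma integral_scaled_indic (c : R) (B : set T) : (0 <= c)%R -> measurable B ->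
  \int[P]_w (c * (w \in B)%:R)%:E = c%:E * P B.
Proof.
move=> c0 mB; under eq_integral do rewrite EFinM.
rewrite ge0_integralZl//.
- by congr (_ * _); have := integral_indic P measurableT mB; rewrite setIT.
- by have := measurable_scaled_indic 1 mB; under eq_fun do rewrite mul1r.
Qed.

Lemma measurable_dyadic_sum (r : R) (B : nat -> set T) :
  (forall j, measurable (B j)) ->
  measurable_fun setT (fun w => dyadic_sum r (fun j => w \in B j)).
Proof.
move=> mB; apply: ge0_emeasurable_sum => [j w _ _|j _].
  by rewrite lee_fin mulr_ge0 ?dyadic_coef_ge0.
exact: measurable_scaled_indic.
Qed.

Lemma integral_dyadic_sum (r eta : R) (B : nat -> set T) : (0 <= eta)%R ->
  (forall j, measurable (B j)) -> (forall j, P (B j) <= (eta / 8 ^+ j)%:E) ->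
  \int[P]_w dyadic_sum r (fun j => w \in B j) <= (8 * eta * r ^+ 2)%:E.
Proof.
move=> e0 mB hB.
have t0 j := dyadic_coef_ge0 r j.+1.
rewrite /dyadic_sum integral_nneseries//; last 2 first.
- by move=> j; exact: measurable_scaled_indic.
- by move=> j w _; rewrite lee_fin mulr_ge0.
have term j : \int[P]_w (4 ^+ j.+1 * r ^+ 2 * (w \in B j)%:R)%:E <=
    (4 * eta * r ^+ 2 * (1 / 2) ^+ j)%:E.
  rewrite integral_scaled_indic//.
  apply: (@le_trans _ _ ((4 ^+ j.+1 * r ^+ 2)%:E * (eta / 8 ^+ j)%:E)).
    by apply: lee_wpmul2l; rewrite ?lee_fin.
  rewrite -EFinM lee_fin le_eqVlt; apply/orP; left; apply/eqP.
  have -> : ((8 : R) ^+ j = 4 ^+ j * 2 ^+ j)%R by rewrite -exprMn; congr (_ ^+ _)%R; ring.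
  rewrite exprS expr_div_n expr1n; field.
  by rewrite !expf_neq0.
apply: lime_le.
  by apply: is_cvg_nneseries => j _ _; apply: integral_ge0 => w _; rewrite lee_fin mulr_ge0.
near=> n; apply: (@le_trans _ _ (\sum_(0 <= j < n) (4 * eta * r ^+ 2 * (1 / 2) ^+ j)%:E)).
  by apply: lee_sum => j _; exact: term.
rewrite sumEFin lee_fin -mulr_sumr big_mkord.
have -> : (8 * eta * r ^+ 2 = 4 * eta * r ^+ 2 * 2)%R by ring.
apply: ler_wpM2l; last exact: sum_pow_half.
by rewrite mulr_ge0 ?sqr_ge0// mulr_ge0.
Unshelve. all: by end_near. Qed.

(* Three scales: up to [r] nothing is lost, between [r] and [u] and above [l] the
   tail is summed dyadically, and between [u] and [l] one event suffices. *)
Lemma second_moment_le (V : T -> \bar R) (r u l eta q eta' : R)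
    (Bn Bf : nat -> set T) (Bm : set T) :
  (0 < r)%R -> (0 < l)%R -> (0 <= eta)%R -> (0 <= eta')%R ->
  (forall w, 0 <= V w) ->
  (forall j, measurable (Bn j)) -> (forall j, P (Bn j) <= (eta / 8 ^+ j)%:E) ->
  (forall j w, (2 ^+ j * r < u)%R -> (2 ^+ j * r)%:E < V w -> Bn j w) ->
  measurable Bm -> P Bm <= q%:E ->
  (forall w, u%:E < V w -> V w <= l%:E -> Bm w) ->
  (forall j, measurable (Bf j)) -> (forall j, P (Bf j) <= (eta' / 8 ^+ j)%:E) ->
  (forall j w, (2 ^+ j * l)%:E < V w -> Bf j w) ->
  \int[P]_w (V w ^+ 2) <=
    (r ^+ 2 + 8 * eta * r ^+ 2 + l ^+ 2 * q + 8 * eta' * l ^+ 2)%:E.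
Proof.
move=> r0 l0 e0 e'0 V0 mBn PBn hBn mBm PBm hBm mBf PBf hBf.
pose g1 w := dyadic_sum r (fun j => w \in Bn j).
pose g2 w : \bar R := (l ^+ 2 * (w \in Bm)%:R)%:E.
pose g3 w := dyadic_sum l (fun j => w \in Bf j).
have g10 w : 0 <= g1 w by exact: dyadic_sum_ge0.
have g20 w : 0 <= g2 w by rewrite lee_fin mulr_ge0 ?sqr_ge0.
have g30 w : 0 <= g3 w by exact: dyadic_sum_ge0.
have mg1 : measurable_fun setT g1 by exact: measurable_dyadic_sum.
have mg3 : measurable_fun setT g3 by exact: measurable_dyadic_sum.
have mg2 : measurable_fun setT g2 by exact: measurable_scaled_indic.
apply: (@le_trans _ _ (\int[P]_w ((r ^+ 2)%:E + g1 w + g2 w + g3 w))).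
  apply: ge0_le_integralT => w; first by rewrite expe2 mule_ge0.
  have r20 : 0 <= (r ^+ 2)%:E :> \bar R by rewrite lee_fin sqr_ge0.
  have sq x : (0 <= x)%R -> V w <= x%:E -> V w ^+ 2 <= (x ^+ 2)%:E.
    by move=> x0 Vx; rewrite expe2 expr2 EFinM; apply: lee_pmul.
  case: (leP (V w) r%:E) => [Vr|rV].
    apply: le_trans (sq _ (ltW r0) Vr) _.
    by rewrite -!addeA leeDl// !adde_ge0.
  case: (leP (V w) u%:E) => [Vu|uV].
    apply: (@le_trans _ _ (g1 w)).
      apply: sqr_le_dyadic_sum => // j jV; apply/mem_set; apply: hBn => //.
      by rewrite -lte_fin; exact: lt_le_trans Vu.
    by rewrite -addeA (addeC _ (g1 w)) -addeA leeDl// !adde_ge0.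
  case: (leP (V w) l%:E) => [Vl|lV].
    apply: (@le_trans _ _ (g2 w)).
      by rewrite /g2 mem_set ?mulr1; [exact: sq (ltW l0) Vl|exact: hBm].
    by rewrite (addeC _ (g2 w)) -addeA leeDl// !adde_ge0.
  apply: (@le_trans _ _ (g3 w)).
    by apply: sqr_le_dyadic_sum => // j jV; apply/mem_set; exact: hBf.
  by rewrite (addeC _ (g3 w)) leeDl// !adde_ge0.
rewrite !ge0_integralD//; last 5 first.
all: try exact: emeasurable_funD.
all: try (by move=> *; rewrite ?adde_ge0// ?lee_fin ?sqr_ge0).
  by apply: emeasurable_funD => //; exact: emeasurable_funD.
rewrite !EFinD.
apply: leeD; last exact: integral_dyadic_sum.
apply: leeD.
  apply: leeD; last exact: integral_dyadic_sum.
  by rewrite integral_cst//= probability_setT mule1.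
rewrite /g2 integral_scaled_indic ?sqr_ge0//.
by rewrite [leRHS]EFinM; apply: lee_wpmul2l; rewrite ?lee_fin ?sqr_ge0.
Qed.

End SecondMoment.

Section NormEvents.
Context {R : realType} {dsp : measure_display} {T : measurableType dsp}.
Variables (P : probability T R) (d' N : nat) (delta : R).
Let d := d'.+1.
Variables (phi : 'I_N -> T -> 'rV[R]_d) (eps : 'I_N -> T -> R).
Hypothesis hmodel : model P delta phi eps.
Hypothesis delta_gt0 : 0 < delta.
Local Notation W w := (`|WN delta phi eps w|)%E.

Lemma WN_gt (r : R) w : (r%:E < W w)%E ->
  (exists n, delta < `|eps n w|) \/
  exists2 x, PN delta phi eps w x & r < enorm x.
Proof.
have [/forallP hE|] := boolP [forall n, `|eps n w| <= delta]; last first.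
  by rewrite negb_forall => /existsP[n]; rewrite -ltNge => hn _; left; exists n.
have W0 : (0 <= WN delta phi eps w)%E.
  apply: (@le_trans _ _ (enorm (0 : 'rV[R]_d))%:E); first by rewrite lee_fin enorm_ge0.
  apply: ereal_sup_ubound; exists 0 => // n.
  by rewrite /PN /= -(scale0r (0 : 'rV[R]_d)) dotpZl mul0r sub0r normrN.
rewrite gee0_abs// => /ereal_sup_gt[_ [x hx <-]]; rewrite lte_fin => rx.
by right; exists x.
Qed.

Lemma norm_event (K : finType) (e : K -> 'rV[R]_d) (c r a s : R) :
  (forall k, enorm (e k) = 1) -> 0 < c -> 0 < r ->
  (forall x, x != 0 -> exists k, c * enorm x <= dotp x (e k)) ->
  0 <= a <= delta -> 0 <= s ->
  (forall n v, c * r <= enorm v ->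
     (P [set w | survives delta phi eps a n v w] <= s%:E)%E) ->
  exists B : set T, [/\ measurable B,
    (P B <= (#|K|%:R * \sum_(tau : {ffun 'I_N -> option bool} | (#|tau_supp tau| < d)%N)
        (a / delta) ^+ #|tau_supp tau| * s ^+ (N - #|tau_supp tau|))%:E)%E &
    forall w, (r%:E < W w)%E -> B w].
Proof.
move=> e1 c0 r0 cover ad s0 hs.
have [B [mB PB hB1 hB2]] :=
  vertex_union_bound hmodel delta_gt0 e1 (mulr_gt0 c0 r0) ad s0 hs.
exists B; split => // w /WN_gt[[n]|[x hx rx]]; first exact: hB2.
have x0 : x != 0.
  apply: contraTneq rx => ->; rewrite -leNgt /enorm.
  by rewrite -(scale0r (0 : 'rV[R]_d)) dotpZl mul0r sqrtr0 ltW.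
have [k hk] := cover x x0; apply: (hB1 w x k) => //.
by apply: le_trans hk; rewrite ler_pM2l// ltW.
Qed.

Let sd0 : 0 < Num.sqrt d%:R :> R. Proof. by rewrite sqrtr_gt0 ltr0n. Qed.

(* The axes lose a factor [sqrt d] but are only [2 d] many. A vertex uses at most
   [d - 1] of the [N >= d + 2] slabs, so that at least three slabs are left to
   produce the factor [8^-j]. *)
Lemma far_event j : (d + 2 <= N)%N ->
  exists B : set T, [/\ measurable B,
    (P B <= ((2 * d%:R * 10 ^+ d' * (3 / 5) ^+ N) / 8 ^+ j)%:E)%E &
    forall w, ((2 ^+ j * (10 * delta * d%:R))%:E < W w)%E -> B w].
Proof.
move=> dN; have dR : 0 < d%:R :> R by rewrite ltr0n.
have j0 : 0 < 2 ^+ j :> R by rewrite exprn_gt0.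
pose h : R := (1 / 2) ^+ j; have h0 : 0 < h by rewrite exprn_gt0//; lra.
have h2 : h * 2 ^+ j = 1 by rewrite -exprMn (_ : 1 / 2 * 2 = 1) ?expr1n//; lra.
have h1 : h <= 1 by rewrite exprn_ile1//; lra.
have [|||||||B [mB PB hB]] := @norm_event _ (@axis R d) (Num.sqrt d%:R)^-1
    (2 ^+ j * (10 * delta * d%:R)) delta (2 / 5 * h).
- exact: enorm_axis.
- by rewrite invr_gt0.
- by rewrite mulr_gt0// mulr_gt0// mulr_gt0.
- move=> x _; have [k hk] := axis_cover x (ltn0Sn d').
  by exists k; rewrite mulrC.
- by rewrite lexx ltW.
- by rewrite mulr_ge0// ltW.
- move=> n v; set t := (X in X <= _) => tv.
  have t0 : 0 < t by rewrite /t mulr_gt0 ?invr_gt0// !mulr_gt0.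
  apply: le_trans (survives_prob_far hmodel delta_gt0 (ltn0Sn d') n t0 tv) _.
  rewrite lee_fin ler_pdivrMr// /t.
  have q2 : Num.sqrt d%:R ^+ 2 = d%:R :> R by rewrite sqr_sqrtr.
  set q := Num.sqrt d%:R in q2 *; rewrite -q2.
  have -> : 2 / 5 * h * (q^-1 * (2 ^+ j * (10 * delta * q ^+ 2))) =
      (h * 2 ^+ j) * (4 * delta * q) by field; rewrite gt_eqF.
  by rewrite h2 mul1r.
exists B; split => //; apply: le_trans PB _; rewrite lee_fin.
rewrite card_prod card_ord card_bool natrM (mulrC _ 2%:R).
rewrite -!mulrA ler_pM2l// ler_pM2l//.
have h8 : 8 ^- j = h ^+ 3 by rewrite /h -exprM mulnC exprM -exprVn; congr (_ ^+ _); field.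
have tau_le : \sum_(tau : {ffun 'I_N -> option bool} | (#|tau_supp tau| < d)%N)
    (2 / 5 : R) ^+ (N - #|tau_supp tau|) <= 10 ^+ d' * (3 / 5) ^+ N.
  have := @tau_sum_le R N d' 1 (2 / 5) 10 ltac:(lra) ltac:(lra) ltac:(lra).
  rewrite (_ : 2 / 5 + 2 * (1 / 10) = 3 / 5); last by field.
  by apply: le_trans; apply: ler_sum => tau _; rewrite expr1n mul1r.
rewrite [leRHS]mulrA; apply: le_trans (ler_wpM2r _ tau_le); last first.
  by rewrite invr_ge0 exprn_ge0.
rewrite mulr_suml; apply: ler_sum => tau td.
rewrite divff ?gt_eqF// expr1n mul1r (_ : 2 * (5^-1 * h) = 2 / 5 * h) ?mulrA//.
rewrite exprMn ler_wpM2l ?exprn_ge0//.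
rewrite h8; apply: ler_wiXn2l => //; first exact: ltW.
have : (#|tau_supp tau| <= d')%N by [].
by move: dN; rewrite /d => dN td'; rewrite leq_subRL; lia.
Qed.

(* Only the data with [|eps_n| >= delta - rho delta] are used: the expected number
   of them is [rho N], not [N], and this avoids a factor [log (N / d)]. *)
Lemma near_event (r : R) : 0 < r -> r <= 8 * delta * Num.sqrt d%:R ->
  exists B : set T, [/\ measurable B,
    (P B <= (64 ^+ d * (64 ^+ d' *
       (1 - 7 / 32 * (r / (8 * delta * Num.sqrt d%:R))) ^+ N))%:E)%E &
    forall w, (r%:E < W w)%E -> B w].
Proof.
move=> r0 rd; pose rho := r / (8 * delta * Num.sqrt d%:R).
have rho0 : 0 < rho by rewrite divr_gt0// !mulr_gt0.
have rho1 : rho <= 1 by rewrite ler_pdivrMr ?mul1r// !mulr_gt0.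
have [|||||||B [mB PB hB]] := @norm_event _ (@net R d) (1 / 2) r (rho * delta) (1 - rho / 4).
- exact: enorm_net.
- by lra.
- by [].
- move=> x x0; have [k hk] := net_cover (ltn0Sn d') x0.
  by exists k; rewrite mul1r mulrC.
- by rewrite mulr_ge0 ?(ltW rho0) ?(ltW delta_gt0)//= ger_pMl.
- by lra.
- move=> n v tv.
  have t0 : 0 < 1 / 2 * r by lra.
  have aE : rho * delta = 1 / 2 * r / (4 * Num.sqrt d%:R).
    by rewrite /rho; field; rewrite !gt_eqF.
  have ad : rho * delta <= delta by rewrite ger_pMl.
  have := survives_prob_near hmodel delta_gt0 (ltn0Sn d') n t0 tv aE ad.
  by rewrite mulfK ?gt_eqF.
exists B; split => //; apply: le_trans PB _; rewrite lee_fin mulfK ?gt_eqF//.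
apply: ler_pM.
- by rewrite ler0n.
- by apply: sumr_ge0 => tau _; rewrite mulr_ge0 ?exprn_ge0//; lra.
- exact: card_net.
have := @tau_sum_le _ N d' rho (1 - rho / 4) 64 (ltW rho0) ltac:(lra) ltac:(lra).
move=> /le_trans; apply; rewrite ler_wpM2l ?exprn_ge0// lerXn2r ?nnegrE//; rewrite -/rho; lra.
Qed.

End NormEvents.

(** * Numerical estimates *)

Section Numerics.
Context {R : realType}.

Lemma expR1_ge : 8 / 3 <= expR 1 :> R.
Proof.
have -> : expR 1 = expR (1 / 32) ^+ 32 :> R.
  by rewrite -expRM_natl; congr expR; field.
apply: (@le_trans _ _ ((33 / 32) ^+ 32)); first lra.
rewrite lerXn2r ?nnegrE ?expR_ge0//.
by apply: le_trans (expR_ge1Dx _); lra.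
Qed.

Lemma expR_nat_ge n : (8 / 3) ^+ n <= expR n%:R :> R.
Proof.
rewrite -[n%:R]mulr1 expRM_natl lerXn2r ?nnegrE ?expR_ge0//.
exact: expR1_ge.
Qed.

Lemma expR_ge_sqr (x : R) : 0 <= x -> x ^+ 2 / 4 <= expR x.
Proof.
move=> x0; have -> : expR x = expR (x / 2) ^+ 2.
  by rewrite -expRM_natl; congr expR; field.
have -> : x ^+ 2 / 4 = (x / 2) ^+ 2 by field.
rewrite lerXn2r ?nnegrE ?expR_ge0 ?divr_ge0//.
by apply: le_trans (expR_ge1Dx _); lra.
Qed.

Lemma onem_exprn_le_expR (x : R) n : 0 <= x <= 1 -> (1 - x) ^+ n <= expR (- (n%:R * x)).
Proof.
move=> /andP[x0 x1]; rewrite -mulrN expRM_natl lerXn2r ?nnegrE ?expR_ge0//; first lra.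
by apply: le_trans (expR_ge1Dx _); lra.
Qed.

Definition first_term (d N : nat) : R :=
  2 * expR 12 * d%:R ^+ 3 / (N.+1%:R * N.+2%:R).

Definition second_term (d N : nat) : R :=
  26 * Num.sqrt d%:R ^+ 3 * Num.sqrt (11 / 12) ^+ N * (32 * Num.sqrt d%:R) ^+ d.

Lemma expR12_ge : 359 ^+ 2 <= expR 12 :> R.
Proof. by apply: le_trans (expR_nat_ge 12); lra. Qed.

Lemma first_term_ge0 d N : 0 <= first_term d N.
Proof. by rewrite divr_ge0 ?mulr_ge0 ?expR_ge0 ?exprn_ge0. Qed.

Lemma second_term_ge0 d N : 0 <= second_term d N.
Proof. by rewrite !mulr_ge0 ?exprn_ge0 ?mulr_ge0 ?sqrtr_ge0. Qed.

Lemma sqrt_1112_ge : 95 / 100 <= Num.sqrt (11 / 12) :> R.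
Proof.
have -> : 95 / 100 = Num.sqrt ((95 / 100) ^+ 2) :> R by rewrite sqrtr_sqr ger0_norm; lra.
by rewrite ler_wsqrtr//; lra.
Qed.

Lemma far_term_le d' N : (d'.+1 + 2 <= N)%N ->
  40 ^+ 2 * d'.+1%:R ^+ 3 * 10 ^+ d' * (3 / 5) ^+ N <= second_term d'.+1 N / 2.
Proof.
move=> dN; rewrite /second_term; set q := Num.sqrt d'.+1%:R; set b := Num.sqrt (11 / 12).
have q2 : d'.+1%:R = q ^+ 2 :> R by rewrite sqr_sqrtr.
have q1 : 1 <= q by rewrite -sqrtr1 ler_wsqrtr// ler1n.
have b95 : 95 / 100 <= b by exact: sqrt_1112_ge.
have q0 : 0 <= q by lra. have b0 : 0 <= b by lra.
have step1 : (3 / 5 : R) ^+ N <= (12 / 19) ^+ (d' + 3) * b ^+ N.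
  apply: (@le_trans _ _ ((12 / 19 * b) ^+ N)).
    by rewrite lerXn2r ?nnegrE//; lra.
  rewrite exprMn ler_wpM2r ?exprn_ge0//; apply: ler_wiXn2l; [lra|lra|].
  by rewrite addnC; move: dN; lia.
apply: (@le_trans _ _ (40 ^+ 2 * d'.+1%:R ^+ 3 * 10 ^+ d' * ((12 / 19) ^+ (d' + 3) * b ^+ N))).
  by rewrite ler_wpM2l// !mulr_ge0 ?exprn_ge0.
have q25 : q ^+ 2 <= 5 ^+ d'.
  rewrite -q2 -natrX ler_nat; apply: leq_trans (_ : 2 ^ d' <= _)%N; first exact: ltn_expl.
  by case: (d') => // k; rewrite leq_exp2r.
have qd : 1 <= q ^+ d' by exact: exprn_ege1.
have pows : (120 / 19 : R) ^+ d' * 5 ^+ d' <= 32 ^+ d'.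
  by rewrite -exprMn lerXn2r ?nnegrE//; lra.
rewrite q2 exprD [(32 * q) ^+ _]exprMn [32 ^+ _]exprS [q ^+ d'.+1]exprS.
have -> : 40 ^+ 2 * (q ^+ 2) ^+ 3 * 10 ^+ d' * ((12 / 19) ^+ d' * (12 / 19) ^+ 3 * b ^+ N) =
    (40 ^+ 2 * (12 / 19) ^+ 3) * (q ^+ 3 * b ^+ N * q) * (q ^+ 2 * (120 / 19) ^+ d').
  have -> : (120 / 19 : R) ^+ d' = 10 ^+ d' * (12 / 19) ^+ d'.
    by rewrite -exprMn; congr (_ ^+ _); field.
  by ring.
have -> : 26 * q ^+ 3 * b ^+ N * (32 * 32 ^+ d' * (q * q ^+ d')) / 2 =
    (13 * 32) * (q ^+ 3 * b ^+ N * q) * (32 ^+ d' * q ^+ d') by field.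
have Q0 : 0 <= q ^+ 3 * b ^+ N * q by rewrite !mulr_ge0// exprn_ge0.
apply: ler_pM.
- by rewrite mulr_ge0//; lra.
- by rewrite mulr_ge0 ?exprn_ge0//; lra.
- by rewrite ler_wpM2r//; lra.
apply: (@le_trans _ _ (32 ^+ d')); last by rewrite ler_peMr// exprn_ge0.
apply: le_trans pows; rewrite mulrC ler_wpM2l// exprn_ge0//; lra.
Qed.

Lemma small_sample_le d' N : (N <= 56 * d'.+1)%N ->
  100 * d'.+1%:R ^+ 2 <= first_term d'.+1 N + second_term d'.+1 N / 2.
Proof.
move=> Nd; rewrite /second_term; set q := Num.sqrt d'.+1%:R; set b := Num.sqrt (11 / 12).
have q2 : d'.+1%:R = q ^+ 2 :> R by rewrite sqr_sqrtr.
have q1 : 1 <= q by rewrite -sqrtr1 ler_wsqrtr// ler1n.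
have b95 : 95 / 100 <= b by exact: sqrt_1112_ge.
have b2 : b ^+ 2 = 11 / 12 by rewrite sqr_sqrtr//; lra.
have b1 : b <= 1 by rewrite -sqrtr1 ler_wsqrtr//; lra.
have q0 : 0 <= q by lra. have b0 : 0 <= b by lra.
have step : (272 / 100) ^+ d'.+1 <= b ^+ N * 32 ^+ d'.+1.
  apply: (@le_trans _ _ (b ^+ (56 * d'.+1) * 32 ^+ d'.+1)).
    rewrite (_ : 56 * d'.+1 = (2 * 28) * d'.+1)%N// !exprM b2 -exprMn.
    have p7 : 27 / 50 <= (11 / 12 : R) ^+ 7 by lra.
    have p28 : (27 / 50) ^+ 4 <= (11 / 12 : R) ^+ 28.
      rewrite [leRHS](exprM _ 7 4); apply: lerXn2r p7; rewrite nnegrE; first lra.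
      by apply: exprn_ge0; lra.
    apply: lerXn2r; rewrite ?nnegrE; first lra.
      by apply: mulr_ge0; [apply: exprn_ge0|]; lra.
    by move: p28; set z := _ ^+ 28; lra.
  by rewrite ler_wpM2r ?exprn_ge0//; exact: ler_wiXn2l.
have E : 26 * q ^+ 3 * b ^+ N * (32 * q) ^+ d'.+1 / 2 =
    13 * q ^+ 3 * q ^+ d'.+1 * (b ^+ N * 32 ^+ d'.+1).
  by rewrite exprMn; field.
rewrite E.
have c0 : 0 <= 13 * q ^+ 3 * q ^+ d'.+1 by rewrite !mulr_ge0// exprn_ge0.
have := ler_wpM2l c0 step.
set s := (X in _ <= X) => hs.
case: d' @q q2 q1 q0 Nd step E c0 @s hs => [|d'] q q2 q1 q0 Nd step E c0 s hs.
  have q_1 : q = 1 by rewrite /q sqrtr1.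
  have f : 77 <= first_term 1 N.
    rewrite /first_term ler_pdivlMr ?mulr_gt0// expr1n mulr1.
    have hN : (N.+1%:R * N.+2%:R : R) <= 57 * 58.
      by apply: ler_pM; rewrite ?ler0n// ler_nat !ltnS (leq_trans Nd).
    by have := expR12_ge; lra.
  rewrite q_1 !expr1n in hs *; rewrite expr1 in hs; lra.
apply: le_trans (_ : s <= _); last by rewrite lerDr first_term_ge0.
apply: le_trans hs.
have q22 : 2 <= q ^+ 2 by rewrite -q2 ler_nat.
have q14 : 14 / 10 <= q by nra.
have p : (272 / 100) ^+ 2 <= (272 / 100) ^+ d'.+2 :> R by rewrite ler_weXn2l//; lra.
have qp : q ^+ 2 <= q ^+ d'.+2 by rewrite ler_weXn2l.
rewrite q2; apply: (@le_trans _ _ (13 * q ^+ 3 * q ^+ 2 * (272 / 100) ^+ 2)).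
  have -> : 13 * q ^+ 3 * q ^+ 2 * (272 / 100) ^+ 2 =
     (13 * (272 / 100) ^+ 2 * q) * (q ^+ 2) ^+ 2 by ring.
  by rewrite ler_wpM2r ?exprn_ge0//; lra.
have q30 : 0 <= 13 * q ^+ 3 by rewrite mulr_ge0// exprn_ge0.
apply: ler_pM p; first by rewrite mulr_ge0// exprn_ge0.
  by apply: exprn_ge0; lra.
exact: ler_wpM2l.
Qed.

Lemma near_prob_le d' N j : (0 < N)%N -> (56 * d'.+1 < N)%N ->
  2 ^+ j * (56 * d'.+1%:R) <= N%:R :> R ->
  64 ^+ d'.+1 * (64 ^+ d' * (1 - 7 / 32 * (2 ^+ j * (56 * d'.+1%:R) / N%:R)) ^+ N)
  <= 1 / 44 ^+ 2 / 8 ^+ j :> R.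
Proof.
move=> N0 dN jN; have N0R : 0 < N%:R :> R by rewrite ltr0n.
set x : R := 2 ^+ j * (56 * d'.+1%:R) / N%:R.
have x0 : 0 <= x by rewrite divr_ge0 ?mulr_ge0 ?exprn_ge0.
have x1 : x <= 1 by rewrite ler_pdivrMr// mul1r.
have eb : (1 - 7 / 32 * x) ^+ N <= expR (- 12) ^+ (d'.+1 * j.+1).
  apply: le_trans (onem_exprn_le_expR N _) _; first by apply/andP; split; lra.
  rewrite -expRM_natl ler_expR mulrN lerN2.
  have -> : N%:R * (7 / 32 * x) = (7 / 32 * 56) * (d'.+1%:R * 2 ^+ j).
    by rewrite /x; field; rewrite gt_eqF.
  rewrite natrM [leRHS]mulrC; apply: ler_pM; rewrite ?mulr_ge0//; [|lra].
  by rewrite ler_wpM2l// -natrX ler_nat ltn_expl.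
set e := expR (- 12) in eb.
have e_ge0 : 0 <= e by exact: expR_ge0.
have eE : e * expR 12 = 1 by rewrite /e expRN mulVf// gt_eqF// expR_gt0.
have e_le : e * (64 * 44 ^+ 2) <= 1.
  apply: (@le_trans _ _ (e * expR 12)); last by rewrite eE.
  by apply: ler_wpM2l => //; apply: le_trans expR12_ge; lra.
apply: (@le_trans _ _ (64 ^+ d'.+1 * (64 ^+ d' * e ^+ (d'.+1 * j.+1)))).
  by do 2 (apply: ler_wpM2l; first exact: exprn_ge0).
have -> : 64 ^+ d'.+1 * (64 ^+ d' * e ^+ (d'.+1 * j.+1)) =
    64 * (64 ^+ 2 * e ^+ j.+1) ^+ d' * e ^+ j.+1.
  have e64 : (64 ^+ 2) ^+ d' = 64 ^+ d' * 64 ^+ d' :> R by rewrite -exprMn.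
  rewrite mulSn exprD (mulnC d') exprM exprMn e64 exprS.
  by rewrite -!mulrA; do 3 congr (_ * _); rewrite mulrC.
have j80 : 0 <= (1 / 8) ^+ j :> R by rewrite exprn_ge0//; lra.
have small : e ^+ j.+1 <= e * (1 / 8) ^+ j.
  rewrite exprS; apply: ler_wpM2l => //; apply: lerXn2r; rewrite ?nnegrE; lra.
have j8 : (1 / 8) ^+ j <= 1 :> R by rewrite exprn_ile1//; lra.
have ej0 : 0 <= e ^+ j.+1 by exact: exprn_ge0.
have ej1 : e ^+ j.+1 <= e by apply: le_trans small _; rewrite ler_piMr.
have t1 : (64 ^+ 2 * e ^+ j.+1) ^+ d' <= 1.
  by apply: exprn_ile1; [rewrite mulr_ge0|lra].
have -> : 1 / 44 ^+ 2 / 8 ^+ j = 1 / 44 ^+ 2 * (1 / 8) ^+ j :> R.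
  by congr (_ * _); rewrite div1r exprVn.
apply: (@le_trans _ _ (64 * 1 * (e * (1 / 8) ^+ j))).
  apply: ler_pM small => //.
    by rewrite mulr_ge0// exprn_ge0// mulr_ge0.
  exact: ler_wpM2l.
rewrite mulr1 mulrA; apply: ler_wpM2r => //; lra.
Qed.

Lemma middle_prob_le d' N : (56 * d'.+1 < N)%N ->
  100 * d'.+1%:R ^+ 2 * (64 ^+ d'.+1 * (64 ^+ d' * (1 - 7 / 32) ^+ N))
  <= 100 ^+ 2 * d'.+1%:R ^+ 3 / N%:R ^+ 2 :> R.
Proof.
move=> dN; have N0R : 0 < N%:R :> R by rewrite ltr0n; exact: leq_ltn_trans dN.
have h1 : 0 <= (7 / 32 : R) <= 1 by lra.
have eb := onem_exprn_le_expR N h1.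
have -> : 64 ^+ d'.+1 * (64 ^+ d' * (1 - 7 / 32) ^+ N) =
    (64 ^+ 2) ^+ d'.+1 * (1 - 7 / 32) ^+ N / 64 :> R.
  have -> : (64 ^+ 2) ^+ d'.+1 = 64 ^+ d'.+1 * 64 ^+ d'.+1 :> R by rewrite -exprMn.
  by rewrite !exprS; field.
have dR : 1 <= d'.+1%:R :> R by rewrite ler1n.
have key : N%:R ^+ 2 * ((64 ^+ 2) ^+ d'.+1 * (1 - 7 / 32) ^+ N) <= 64 ^+ 2 :> R.
  apply: (@le_trans _ _ (N%:R ^+ 2 * ((64 ^+ 2) ^+ d'.+1 *
      (expR (- (N%:R / 32)) * expR (- 10) ^+ d'.+1)))).
    do 2 (rewrite ler_wpM2l ?exprn_ge0//).
    apply: le_trans eb _; rewrite -expRM_natl -expRD ler_expR.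
    have : 56 * d'.+1%:R <= N%:R :> R by rewrite -natrM ler_nat ltnW.
    lra.
  have e10 : expR (- 10) <= 1 / 64 ^+ 2 :> R.
    rewrite expRN div1r lef_pV2 ?posrE ?expR_gt0//.
    by apply: le_trans (expR_nat_ge 10); lra.
  have p : (64 ^+ 2 * expR (- 10)) ^+ d'.+1 <= 1 :> R.
    by apply: exprn_ile1; [rewrite mulr_ge0 ?expR_ge0|lra].
  have sq : N%:R ^+ 2 * expR (- (N%:R / 32)) <= 64 ^+ 2 :> R.
    rewrite expRN ler_pdivrMr ?expR_gt0//.
    have := expR_ge_sqr (_ : 0 <= N%:R / 32 :> R) => /(_ ltac:(by rewrite divr_ge0)); lra.
  have -> : N%:R ^+ 2 * ((64 ^+ 2) ^+ d'.+1 * (expR (- (N%:R / 32)) * expR (- 10) ^+ d'.+1)) =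
     (N%:R ^+ 2 * expR (- (N%:R / 32))) * (64 ^+ 2 * expR (- 10)) ^+ d'.+1 :> R.
    by rewrite [X in _ = _ * X]exprMn; ring.
  rewrite -[leRHS]mulr1; apply: ler_pM sq p.
    by apply: mulr_ge0; [exact: exprn_ge0|exact: expR_ge0].
  by apply: exprn_ge0; apply: mulr_ge0; [exact: exprn_ge0|exact: expR_ge0].
rewrite ler_pdivlMr ?exprn_gt0//.
set X := (64 ^+ 2) ^+ d'.+1 * _ in key *.
have -> : 100 * d'.+1%:R ^+ 2 * (X / 64) * N%:R ^+ 2 =
   100 / 64 * d'.+1%:R ^+ 2 * (N%:R ^+ 2 * X) by field.
apply: (@le_trans _ _ (100 / 64 * d'.+1%:R ^+ 2 * 64 ^+ 2)).
  by rewrite ler_wpM2l// mulr_ge0 ?exprn_ge0//; lra.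
rewrite [d'.+1%:R ^+ 3]exprS.
have : 0 <= d'.+1%:R ^+ 2 :> R by rewrite exprn_ge0.
set y := d'.+1%:R ^+ 2; nra.
Qed.

Lemma large_sample_le d' N : (56 * d'.+1 < N)%N ->
  (1 + 8 / 44 ^+ 2) * ((8 * 56) ^+ 2 * d'.+1%:R ^+ 3 / N%:R ^+ 2) +
    100 ^+ 2 * d'.+1%:R ^+ 3 / N%:R ^+ 2 <= first_term d'.+1 N.
Proof.
move=> dN; have N57 : 57 <= N%:R :> R by rewrite ler_nat (leq_trans _ dN)// ltnS leq_pmulr.
have N0R : 0 < N%:R :> R by lra.
have d3 : 0 <= d'.+1%:R ^+ 3 :> R by rewrite exprn_ge0.
rewrite /first_term ler_pdivlMr ?mulr_gt0//.
have -> : ((1 + 8 / 44 ^+ 2) * ((8 * 56) ^+ 2 * d'.+1%:R ^+ 3 / N%:R ^+ 2) +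
    100 ^+ 2 * d'.+1%:R ^+ 3 / N%:R ^+ 2) * (N.+1%:R * N.+2%:R) =
  d'.+1%:R ^+ 3 * (((1 + 8 / 44 ^+ 2) * (8 * 56) ^+ 2 + 100 ^+ 2) *
    (N.+1%:R * N.+2%:R / N%:R ^+ 2)) :> R.
  by field; rewrite gt_eqF.
rewrite [leRHS]mulrC ler_wpM2l//.
have ratio : N.+1%:R * N.+2%:R / N%:R ^+ 2 <= 12 / 10 :> R.
  rewrite ler_pdivrMr ?exprn_gt0//.
  have -> : N.+2%:R = N%:R + 1 + 1 :> R by rewrite !natr1.
  have -> : N.+1%:R = N%:R + 1 :> R by rewrite natr1.
  have : 0 <= N%:R * (N%:R - 57) :> R by apply: mulr_ge0; lra.
  lra.
have c0 : 0 <= (1 + 8 / 44 ^+ 2) * (8 * 56) ^+ 2 + 100 ^+ 2 :> R by lra.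
by have := ler_wpM2l c0 ratio; have := expR12_ge; lra.
Qed.

End Numerics.

Section MainBound.
Context {R : realType} {dsp : measure_display} {T : measurableType dsp}.
Variables (P : probability T R) (d N : nat) (delta : R).
Variables (phi : 'I_N -> T -> 'rV[R]_d) (eps : 'I_N -> T -> R).

Lemma EW2_le : model P delta phi eps -> 0 < delta -> (0 < d)%N -> (d + 2 <= N)%N ->
  (EW2 P delta phi eps <= (delta ^+ 2 * (first_term d N + second_term d N))%:E)%E.
Proof.
case: d phi => // d' phi' hmodel delta0 _ dN.
pose far := fun j => far_event hmodel delta0 j dN.
have /choice[Bf hBf] j := far j.
set D : R := d'.+1%:R; have D1 : 1 <= D by rewrite ler1n.
set eta' : R := 2 * D * 10 ^+ d' * (3 / 5) ^+ N.
have eta'0 : 0 <= eta' by rewrite !mulr_ge0 ?exprn_ge0//; lra.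
have d20 : 0 < delta ^+ 2 by rewrite exprn_gt0.
have farE : 8 * eta' * (10 * delta * D) ^+ 2 =
    delta ^+ 2 * (40 ^+ 2 * D ^+ 3 * 10 ^+ d' * (3 / 5) ^+ N) by rewrite /eta'; ring.
have far_le := @far_term_le R _ _ dN; rewrite -/D in far_le.
have V0 w : (0 <= `|WN delta phi' eps w|)%E by exact: abse_ge0.
have l0 : 0 < 10 * delta * D by rewrite !mulr_gt0//; lra.
case: (leqP N (56 * d'.+1)) => [Nd|dN'].
  have small := @small_sample_le R _ _ Nd; rewrite -/D in small.
  apply: le_trans (second_moment_le (r := 10 * delta * D) (u := 10 * delta * D)
    (l := 10 * delta * D) (eta := 0) (q := 0) (eta' := eta')
    (Bn := fun=> set0) (Bf := Bf) (Bm := set0) l0 l0 (lexx 0) eta'0 V0 _ _ _ _ _ _ _ _ _) _.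
  - by [].
  - by move=> j; rewrite measure0 mul0r.
  - move=> j w; rewrite ltNge => /negP[]; rewrite ler_peMl ?exprn_ege1 ?ler1n// ltW//.
  - by [].
  - by rewrite measure0.
  - by move=> w h1 h2; have := lt_le_trans h1 h2; rewrite ltxx.
  - by move=> j; have [] := hBf j.
  - by move=> j; have [] := hBf j.
  - by move=> j w; have [_ _] := hBf j; apply.
  rewrite lee_fin mulr0 mul0r mulr0 !addr0 farE.
  have -> : (10 * delta * D) ^+ 2 = delta ^+ 2 * (100 * D ^+ 2) by ring.
  rewrite -mulrDr; apply: ler_wpM2l; [exact: ltW|lra].
have N0 : (0 < N)%N by exact: leq_ltn_trans dN'.
have N0R : 0 < N%:R :> R by rewrite ltr0n.
set q := Num.sqrt d'.+1%:R : R.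
have q0 : 0 < q by rewrite sqrtr_gt0 ltr0n.
have q2 : q ^+ 2 = D by rewrite sqr_sqrtr.
pose r := 8 * 56 * delta * (D * q) / N%:R; pose u := 8 * delta * q.
have u0 : 0 < u by rewrite !mulr_gt0.
have r0 : 0 < r by rewrite divr_gt0// !mulr_gt0//; lra.
have ru j : 2 ^+ j * r / u = 2 ^+ j * (56 * D) / N%:R.
  by rewrite /r /u; field; rewrite !gt_eqF.
have /choice[Bn hBn] j : exists B : set T, [/\ measurable B,
    (P B <= (1 / 44 ^+ 2 / 8 ^+ j)%:E)%E &
    forall w, (2 ^+ j * r < u) -> ((2 ^+ j * r)%:E < `|WN delta phi' eps w|)%E -> B w].
  have [ju|uj] := ltP (2 ^+ j * r) u; last first.
    by exists set0; split => //; rewrite measure0 lee_fin !divr_ge0.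
  have jr0 : 0 < 2 ^+ j * r by rewrite mulr_gt0 ?exprn_gt0.
  have [B [mB PB hB]] := near_event hmodel delta0 jr0 (ltW ju).
  exists B; split => // [|w _]; last exact: hB.
  apply: le_trans PB _; rewrite lee_fin -/q -/u ru.
  apply: near_prob_le => //; rewrite -/D.
  have : 2 ^+ j * (56 * D) / N%:R < 1 by rewrite -ru ltr_pdivrMr// mul1r.
  by rewrite ltr_pdivrMr// mul1r => /ltW.
have [Bm [mBm PBm hBm]] := near_event hmodel delta0 u0 (lexx u).
rewrite -/q -/u divff ?gt_eqF// mulr1 in PBm.
have eta0 : 0 <= 1 / 44 ^+ 2 :> R by lra.
apply: le_trans (second_moment_le (r := r) (u := u)
    (l := 10 * delta * D) (eta := 1 / 44 ^+ 2) (eta' := eta')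
    (Bn := Bn) (Bf := Bf) (Bm := Bm) r0 l0 eta0 eta'0 V0 _ _ _ mBm PBm _ _ _ _) _.
- by move=> j; have [] := hBn j.
- by move=> j; have [] := hBn j.
- by move=> j w; have [_ _] := hBn j; apply.
- by move=> w h _; exact: hBm.
- by move=> j; have [] := hBf j.
- by move=> j; have [] := hBf j.
- by move=> j w; have [_ _] := hBf j; apply.
rewrite lee_fin farE.
have mid := @middle_prob_le R _ _ dN'; rewrite -/D in mid.
have large := @large_sample_le R _ _ dN'; rewrite -/D in large.
set X := 64 ^+ d'.+1 * _ in mid *.
have -> : r ^+ 2 = delta ^+ 2 * ((8 * 56) ^+ 2 * D ^+ 3 / N%:R ^+ 2).
  by rewrite /r exprMn exprMn [(D * q) ^+ 2]exprMn q2; field; rewrite gt_eqF.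
have -> : (10 * delta * D) ^+ 2 * X = delta ^+ 2 * (100 * D ^+ 2 * X) by ring.
have s0 := @second_term_ge0 R d'.+1 N.
set Y := (8 * 56) ^+ 2 * D ^+ 3 / N%:R ^+ 2 in large *.
have -> : delta ^+ 2 * Y + 8 * (1 / 44 ^+ 2) * (delta ^+ 2 * Y) +
    delta ^+ 2 * (100 * D ^+ 2 * X) +
    delta ^+ 2 * (40 ^+ 2 * D ^+ 3 * 10 ^+ d' * (3 / 5) ^+ N) =
  delta ^+ 2 * ((1 + 8 / 44 ^+ 2) * Y + 100 * D ^+ 2 * X +
    40 ^+ 2 * D ^+ 3 * 10 ^+ d' * (3 / 5) ^+ N) by field.
apply: ler_wpM2l; [exact: ltW|lra].
Qed.

End MainBound.

(** * Growing dimension *)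

Section Asymptotics.
Context {R : realType}.
Local Notation sq d := (Num.sqrt (d%:R : R)).

Lemma second_term_le d N : 32 * 96 ^+ 2 <= sq d -> sq d ^+ 3 <= N%:R :> R ->
  second_term d N <= 26 / sq d :> R.
Proof.
rewrite /second_term; set q := sq d => hq qN.
have q32 : 32 <= q by lra.
have q0 : 0 < q by lra.
have q2 : q ^+ 2 = d%:R by rewrite sqr_sqrtr.
set b := Num.sqrt (11 / 12).
have b0 : 0 <= b by exact: sqrtr_ge0.
have bN : b ^+ N <= expR (- (q ^+ 3 / 24)).
  have b23 : b <= 1 - 1 / 24.
    have -> : 1 - 1 / 24 = Num.sqrt ((1 - 1 / 24) ^+ 2) :> R.
      by rewrite sqrtr_sqr ger0_norm//; lra.
    by apply: ler_wsqrtr; lra.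
  apply: (@le_trans _ _ ((1 - 1 / 24) ^+ N)).
    by apply: lerXn2r => //; rewrite nnegrE; lra.
  apply: le_trans (@onem_exprn_le_expR R (1 / 24) N _) _; first by lra.
  by rewrite ler_expR lerN2; lra.
have eq : 32 * q <= expR (q / 96 * 2).
  apply: le_trans (expR_ge_sqr (_ : 0 <= q / 96 * 2)); last by lra.
  have -> : (q / 96 * 2) ^+ 2 / 4 = q * (q / 96 ^+ 2) by field.
  rewrite [leLHS]mulrC; apply: ler_wpM2l; first exact: ltW.
  by rewrite ler_pdivlMr ?exprn_gt0.
have e1 : (32 * q) ^+ d <= expR (q ^+ 3 / 48).
  apply: (@le_trans _ _ (expR (q / 96 * 2) ^+ d)).
    by apply: lerXn2r => //; rewrite nnegrE ?expR_ge0//; lra.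
  by rewrite -expRM_natl ler_expR -q2 le_eqVlt; apply/orP; left; apply/eqP; field.
have e2 : q ^+ 4 <= expR (q ^+ 3 / 48).
  apply: (@le_trans _ _ (expR (q / 96 * 2) ^+ 4)).
    apply: lerXn2r; rewrite ?nnegrE ?expR_ge0//; first exact: ltW.
    by apply: le_trans eq; lra.
  rewrite -expRM_natl ler_expR.
  have -> : q ^+ 3 / 48 = q ^+ 2 * (q / 96 * 2) by field.
  apply: ler_wpM2r; first by lra.
  by apply: le_trans (_ : 32 * q <= _); [lra|rewrite expr2; apply: ler_wpM2r; lra].
have e3 : b ^+ N * (32 * q) ^+ d <= expR (- (q ^+ 3 / 48)).
  apply: (@le_trans _ _ (expR (- (q ^+ 3 / 24)) * expR (q ^+ 3 / 48))).
    by apply: ler_pM e1 => //; apply: exprn_ge0 => //; lra.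
  by rewrite -expRD ler_expR; lra.
have e4 : expR (- (q ^+ 3 / 48)) <= (q ^+ 4)^-1.
  by rewrite expRN lef_pV2 ?posrE ?expR_gt0 ?exprn_gt0.
have -> : 26 / q = 26 * q ^+ 3 * (q ^+ 4)^-1 by field; rewrite gt_eqF.
rewrite -mulrA; apply: ler_wpM2l; last exact: le_trans e4.
by rewrite mulr_ge0// exprn_ge0// ltW.
Qed.

Lemma near_sqrt_ge (A : R) : \forall d \near \oo, A <= sq d.
Proof.
near=> d; apply: (@le_trans _ _ `|A|); first exact: ler_norm.
rewrite -sqrtr_sqr; apply: ler_wsqrtr; near: d; exact: nbhs_infty_ger.
Unshelve. all: by end_near. Qed.

Lemma near_ln_ge (A : R) : \forall d \near \oo, A <= ln (d%:R : R).
Proof.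
near=> d; rewrite -[A]expRK ler_ln ?posrE ?expR_gt0//.
  by near: d; exact: nbhs_infty_ger.
by apply: (@lt_le_trans _ _ 1) => //; near: d; exact: nbhs_infty_ger.
Unshelve. all: by end_near. Qed.

Lemma absz_ceil_ge (x : R) : 0 <= x -> x <= `|Num.ceil x|%N%:R.
Proof.
move=> x0; rewrite natr_absz ger0_norm ?ceil_ge// ceil_ge0.
by apply: lt_le_trans x0; rewrite ltrN10.
Qed.

Lemma powR_3half d : (d%:R : R) `^ (3 / 2) = sq d ^+ 3.
Proof.
by rewrite mulrC powRrM powR12_sqrt// powR_mulrn// sqrtr_ge0.
Qed.

Lemma sqrt_powR_half (x : R) N : 0 <= x -> x `^ (N%:R / 2) = Num.sqrt x ^+ N.
Proof.
by move=> x0; rewrite mulrC powRrM powR12_sqrt// powR_mulrn// sqrtr_ge0.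
Qed.

Lemma expR_half_ln d : (0 < d)%N ->
  expR (d%:R * ln (1024 * d%:R) / 2) = (32 * sq d) ^+ d :> R.
Proof.
move=> d0; have q0 : 0 < sq d by rewrite sqrtr_gt0 ltr0n.
have -> : 1024 * d%:R = (32 * sq d) ^+ 2 by rewrite exprMn sqr_sqrtr//; ring.
rewrite lnXn ?mulr_gt0// mulrnAr -mulr_natr mulfK// expRM_natl lnK//.
by rewrite posrE mulr_gt0.
Qed.

Lemma bound_termsE d N (delta : R) : (0 < d)%N ->
  2 * expR 12 * delta ^+ 2 * d%:R ^+ 3 / (N.+1%:R * N.+2%:R)
  + 26 * delta ^+ 2 * (d%:R `^ (3 / 2)) * ((11 / 12) `^ (N%:R / 2))
      * expR (d%:R * ln (1024 * d%:R) / 2)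
  = delta ^+ 2 * (first_term d N + second_term d N).
Proof.
move=> d0; rewrite powR_3half sqrt_powR_half; last by lra.
rewrite expR_half_ln// /first_term /second_term.
by rewrite [RHS]mulrDr; congr (_ + _); ring.
Qed.

Lemma sqrt_cube_ge d N : 2 <= sq d -> sq d ^+ 3 <= N%:R :> R -> (d + 2 <= N)%N.
Proof.
move=> q2 qN; rewrite -(ler_nat R) natrD; apply: le_trans qN.
have {1}<- : sq d ^+ 2 = d%:R by rewrite sqr_sqrtr.
set q := sq d in q2 *.
have : 0 <= (q - 2) * q ^+ 2 by apply: mulr_ge0; [lra|exact: sqr_ge0].
have : 0 <= (q - 2) * (q + 2) by apply: mulr_ge0; lra.
have -> : q ^+ 3 = q * q ^+ 2 by ring.
lra.
Qed.

Lemma first_term_le d N (l : R) : 0 < l -> (0 < d)%N -> sq d ^+ 3 * l <= N%:R ->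
  first_term d N <= 2 * expR 12 / l ^+ 2.
Proof.
move=> l0 d0 hN; rewrite /first_term.
have q0 : 0 < sq d by rewrite sqrtr_gt0 ltr0n.
have q2 : sq d ^+ 2 = d%:R by rewrite sqr_sqrtr.
set q := sq d in q0 q2 hN.
have x0 : 0 < q ^+ 3 * l by rewrite mulr_gt0// exprn_gt0.
rewrite -q2 -[leLHS]mulrA; apply: ler_wpM2l; first by rewrite mulr_ge0 ?expR_ge0.
rewrite ler_pdivrMr ?mulr_gt0// ler_pdivlMl ?exprn_gt0//.
have -> : l ^+ 2 * (q ^+ 2) ^+ 3 = (q ^+ 3 * l) * (q ^+ 3 * l) by ring.
apply: ler_pM; try exact: ltW.
  by apply: le_trans hN _; rewrite ler_nat.
by apply: le_trans hN _; rewrite ler_nat -addn2 leq_addr.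
Qed.

End Asymptotics.

Section LargeDimension.
Context {R : realType}.

Lemma EW2_ge0 (dsp : measure_display) (T : measurableType dsp) (P : probability T R)
    (d N : nat) (delta : R) (phi : 'I_N -> T -> 'rV[R]_d) (eps : 'I_N -> T -> R) :
  (0 <= EW2 P delta phi eps)%E.
Proof. by apply: integral_ge0 => w _; rewrite expe2 mule_ge0. Qed.

Lemma EW2_le_asymp (dsp : measure_display) (T : measurableType dsp) (P : probability T R)
    (d N : nat) (delta l : R) (phi : 'I_N -> T -> 'rV[R]_d) (eps : 'I_N -> T -> R) :
  model P delta phi eps -> 0 < delta -> 1 <= l ->
  32 * 96 ^+ 2 <= Num.sqrt d%:R :> R -> Num.sqrt d%:R ^+ 3 * l <= N%:R ->
  (EW2 P delta phi eps <=
    (delta ^+ 2 * (2 * expR 12 / l ^+ 2 + 26 / Num.sqrt d%:R))%:E)%E.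
Proof.
move=> hm delta0 l1 hq hN.
have q2 : 2 <= Num.sqrt d%:R :> R by lra.
have d0 : (0 < d)%N by rewrite -(ltr0n R) -sqrtr_gt0; lra.
have qN : Num.sqrt d%:R ^+ 3 <= N%:R :> R.
  by apply: le_trans hN; rewrite ler_peMr// exprn_ge0// sqrtr_ge0.
apply: le_trans (EW2_le hm delta0 d0 (sqrt_cube_ge q2 qN)) _.
rewrite lee_fin; apply: ler_wpM2l; first exact: sqr_ge0.
apply: lerD; last exact: second_term_le.
by apply: first_term_le => //; lra.
Qed.

Lemma limn_esup_le_near (u : (\bar R)^nat) (C : R) :
  (forall e : R, 0 < e -> \forall n \near \oo, (u n <= (C + e)%:E)%E) ->
  (limn_esup u <= C%:E)%E.
Proof.
move=> h; apply/lee_addgt0Pr => e e0.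
apply: (@le_trans _ _ (ereal_sup (u @` [set n | (u n <= (C + e)%:E)%E]))).
  by apply: ereal_inf_lbound; exists [set n | (u n <= (C + e)%:E)%E] => //; exact: h.
by apply: ge_ereal_sup => _ [n hn <-]; rewrite -EFinD.
Qed.

Lemma cvg0_near (u : (\bar R)^nat) : (forall n, (0 <= u n)%E) ->
  (forall e : R, 0 < e -> \forall n \near \oo, (u n <= e%:E)%E) ->
  u @ \oo --> 0%E.
Proof.
move=> u0 h; apply/fine_cvgP; split.
  near=> n; rewrite ge0_fin_numE//; apply: (@le_lt_trans _ _ 1%E); last exact: ltry.
  by near: n; exact: h.
apply/cvgr0Pnorm_le => e e0; near=> n.
have un : (u n <= e%:E)%E by near: n; exact: h.
rewrite /= ger0_norm ?fine_ge0// -lee_fin fineK// ge0_fin_numE//.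
exact: le_lt_trans un (ltry _).
Unshelve. all: by end_near. Qed.

Lemma limn_esup_EW2_le (delta : R) (dsp : nat -> measure_display)
    (T : forall d, measurableType (dsp d)) (P : forall d, probability (T d) R)
    (N : nat -> nat)
    (phi : forall d, 'I_(N d) -> T d -> 'rV[R]_d) (eps : forall d, 'I_(N d) -> T d -> R) :
  0 < delta -> (forall d, Num.sqrt d%:R ^+ 3 <= (N d)%:R :> R) ->
  (forall d, (1 <= d)%N -> model (P d) delta (phi d) (eps d)) ->
  (limn_esup (fun d => EW2 (P d) delta (phi d) (eps d))
     <= (2 * expR 12 * delta ^+ 2)%:E)%E.
Proof.
move=> delta0 hN hm; apply: limn_esup_le_near => e e0; near=> d.
have d2 : 0 < delta ^+ 2 by rewrite exprn_gt0.
have hq : 32 * 96 ^+ 2 <= Num.sqrt d%:R :> R by near: d; exact: near_sqrt_ge.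
have he : 26 * delta ^+ 2 / e <= Num.sqrt d%:R :> R by near: d; exact: near_sqrt_ge.
have q0 : 0 < Num.sqrt d%:R :> R by lra.
have d0 : (0 < d)%N by rewrite -(ltr0n R) -sqrtr_gt0.
apply: le_trans (EW2_le_asymp (l := 1) (hm d d0) delta0 (lexx 1) hq _) _.
  by rewrite mulr1.
rewrite lee_fin expr1n divr1 mulrDr [delta ^+ 2 * _]mulrC lerD2l.
move: he; rewrite ler_pdivrMr// => he.
by rewrite mulrA ler_pdivrMr// mulrC (mulrC e).
Unshelve. all: by end_near. Qed.

Lemma cvg_EW2_0 (delta : R) (dsp : nat -> measure_display)
    (T : forall d, measurableType (dsp d)) (P : forall d, probability (T d) R)
    (N : nat -> nat)
    (phi : forall d, 'I_(N d) -> T d -> 'rV[R]_d) (eps : forall d, 'I_(N d) -> T d -> R) :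
  0 < delta ->
  (forall d, (1 <= d)%N -> Num.sqrt d%:R ^+ 3 * ln (d%:R : R) <= (N d)%:R) ->
  (forall d, (1 <= d)%N -> model (P d) delta (phi d) (eps d)) ->
  (fun d => EW2 (P d) delta (phi d) (eps d)) @ \oo --> 0%E.
Proof.
move=> delta0 hN hm; apply: cvg0_near => [d|e e0]; first exact: EW2_ge0.
near=> d.
have d2 : 0 < delta ^+ 2 by rewrite exprn_gt0.
have E0 : 0 < 2 * expR 12 :> R by rewrite mulr_gt0 ?expR_gt0.
have hq : 32 * 96 ^+ 2 <= Num.sqrt d%:R :> R by near: d; exact: near_sqrt_ge.
have he : 2 * 26 * delta ^+ 2 / e <= Num.sqrt d%:R :> R by near: d; exact: near_sqrt_ge.
have l1 : 1 <= ln (d%:R : R) by near: d; exact: near_ln_ge.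
have l2 : 2 * (2 * expR 12) * delta ^+ 2 / e <= ln (d%:R : R).
  by near: d; exact: near_ln_ge.
have q0 : 0 < Num.sqrt d%:R :> R by lra.
have l0 : 0 < ln (d%:R : R) by lra.
have d0 : (0 < d)%N by rewrite -(ltr0n R) -sqrtr_gt0.
apply: le_trans (EW2_le_asymp (hm d d0) delta0 l1 hq (hN d d0)) _.
rewrite lee_fin mulrDr.
have -> : e = e / 2 + e / 2 by field.
apply: lerD.
  apply: (@le_trans _ _ (delta ^+ 2 * (2 * expR 12 / ln (d%:R : R)))).
    apply: ler_wpM2l; first exact: ltW.
    apply: ler_wpM2l; first exact: ltW.
    by rewrite lef_pV2 ?posrE ?exprn_gt0// expr2 ler_peMr// ltW.
  rewrite mulrA ler_pdivrMr//; move: l2; rewrite ler_pdivrMr//; lra.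
rewrite mulrA ler_pdivrMr//; move: he; rewrite ler_pdivrMr//; lra.
Unshelve. all: by end_near. Qed.

End LargeDimension.

Theorem theorem6p1 (R : realType) :
  (forall (dsp : measure_display) (T : measurableType dsp) (P : probability T R)
     (d N : nat) (delta : R) (phi : 'I_N -> T -> 'rV[R]_d) (eps : 'I_N -> T -> R),
     (1 <= d)%N -> 0 < delta -> (d + 2 <= N)%N ->
     model P delta phi eps ->
     (EW2 P delta phi eps <=
       ((2 * expR 12 * delta ^+ 2 * d%:R ^+ 3 / (N.+1%:R * N.+2%:R)
        + 26 * delta ^+ 2 * (d%:R `^ (3 / 2)) * ((11 / 12) `^ (N%:R / 2))
          * expR (d%:R * ln (1024 * d%:R) / 2))%:E))%E) /\
  (forall (delta : R) (dsp : nat -> measure_display)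
     (T : forall d, measurableType (dsp d)) (P : forall d, probability (T d) R)
     (phi : forall d, 'I_`|Num.ceil (d%:R `^ (3 / 2) : R)| -> T d -> 'rV[R]_d)
     (eps : forall d, 'I_`|Num.ceil (d%:R `^ (3 / 2) : R)| -> T d -> R),
     0 < delta ->
     (forall d, (1 <= d)%N -> model (P d) delta (phi d) (eps d)) ->
     (limn_esup (fun d => EW2 (P d) delta (phi d) (eps d))
        <= (2 * expR 12 * delta ^+ 2)%:E)%E) /\
  (forall (delta : R) (dsp : nat -> measure_display)
     (T : forall d, measurableType (dsp d)) (P : forall d, probability (T d) R)
     (phi : forall d, 'I_`|Num.ceil (d%:R `^ (3 / 2) * ln (d%:R : R))| -> T d -> 'rV[R]_d)
     (eps : forall d, 'I_`|Num.ceil (d%:R `^ (3 / 2) * ln (d%:R : R))| -> T d -> R),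
     0 < delta ->
     (forall d, (1 <= d)%N -> model (P d) delta (phi d) (eps d)) ->
     (fun d => EW2 (P d) delta (phi d) (eps d)) @ \oo --> 0%E).
Proof.
split; [|split].
- move=> dsp T P d N delta phi eps d1 delta0 dN hm.
  by rewrite bound_termsE//; exact: EW2_le.
- move=> delta dsp T P phi eps delta0 hm.
  apply: (limn_esup_EW2_le delta0 _ hm) => d; rewrite -powR_3half.
  by apply: absz_ceil_ge; exact: powR_ge0.
- move=> delta dsp T P phi eps delta0 hm.
  apply: (cvg_EW2_0 delta0 _ hm) => d d1; rewrite -powR_3half.
  by apply: absz_ceil_ge; rewrite mulr_ge0 ?powR_ge0// ln_ge0// ler1n.
Qed.
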